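(* Let $f:\mathbb{R}^n\to\mathbb{R}$ and let $\{\mathbf{x}_t\}_{t\in\mathbb{N}}$ be the sequence generated by the SZGD algorithm applied to $f$, such that the standing assumptions (i)–(v) listed in the context hold; in particular $f$ is $L$-smooth and is a differentiable Łojasiewicz function with exponent $\theta\in(0,1)$. Suppose the step sizes $\eta_t$ are such that there exist $\eta_-,\eta_+\in(0,\infty)$ with $\eta_-\le\eta_t\le\eta_+$ for all $t$. Then $\{\mathbf{x}_t\}_{t}$ converges almost surely to a critical point $\mathbf{x}_\infty$ of $f$. In addition: (a) if $\theta\in(0,\frac12]$, $-1\le \frac{Ln\eta_-^2}{2k}-\eta_-<0$ and $-1\le\frac{Ln\eta_+^2}{2k}-\eta_+<0$, then there exists a constant $Q>1$ such that $\{Q^t(f(\mathbf{x}_t)-f(\mathbf{x}_\infty))\}_t$ converges to $0$ in expectation, i.e. $\lim_{t\to\infty}\mathbb{E}\left[Q^t(f(\mathbf{x}_t)-f(\mathbf{x}_\infty))\right]=0$; (b) if $\theta\in(\frac12,1)$ and $\eta_-,\eta_+\in\left(0,\frac{2k}{Ln}\right)$, then $\{f(\mathbf{x}_t)-f(\mathbf{x}_\infty)\}_t$ converges to zero at rate $O\left(t^{\frac{1}{1-2\theta}}\right)$ in expectation, i.e. $\mathbb{E}\left[f(\mathbf{x}_t)-f(\mathbf{x}_\infty)\right]= O\left(t^{\frac{1}{1-2\theta}}\right)$ as $t\to\infty$.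
   Context: $\|\cdot\|$ is the Euclidean norm. A critical point of a differentiable $f$ is a point where $\nabla f$ vanishes. $L$-smooth: $f:\mathbb{R}^n\to\mathbb{R}$ is $L$-smooth if it is continuously differentiable and $\|\nabla f(\mathbf{x})-\nabla f(\mathbf{x}')\|\le L\|\mathbf{x}-\mathbf{x}'\|$ for all $\mathbf{x},\mathbf{x}'\in\mathbb{R}^n$. Łojasiewicz function: a differentiable $f$ is a (differentiable) Łojasiewicz function with Łojasiewicz exponent $\theta\in(0,1)$ if for any $\mathbf{x}^*$ with $\nabla f(\mathbf{x}^* )=0$ there exist constants $\kappa,\mu>0$ such that $|f(\mathbf{x})-f(\mathbf{x}^* )|^\theta\le\kappa\|\nabla f(\mathbf{x})\|$ for all $\mathbf{x}$ with $\|\mathbf{x}-\mathbf{x}^*\|\le\mu$. SZGD (Stochastic Zeroth-order Gradient Descent): fix integers $1\le k\le n$, an initial point $\mathbf{x}_0\in\mathbb{R}^n$, $\delta_0=1$ (or $\delta_0\in(0,1)$), and step sizes $\eta_t>0$. Let $\mathrm{St}(n,k)=\{\mathbf{X}\in\mathbb{R}^{n\times k}:\mathbf{X}^\top\mathbf{X}=\mathbf{I}_k\}$. For $t=0,1,2,\dots$: sample (independently of the past) $\mathbf{V}_t=[\mathbf{v}_{t,1},\dots,\mathbf{v}_{t,k}]$ uniformly from $\mathrm{St}(n,k)$, set $$\widehat{\nabla}f_{\mathbf{V}_t}^{\delta_t}(\mathbf{x}_t)=\frac{n}{2\delta_t k}\sum_{i=1}^k\left(f(\mathbf{x}_t+\delta_t\mathbf{v}_{t,i})-f(\mathbf{x}_t-\delta_t\mathbf{v}_{t,i})\right)\mathbf{v}_{t,i},$$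 $\mathbf{x}_{t+1}=\mathbf{x}_t-\eta_t\widehat{\nabla}f_{\mathbf{V}_t}^{\delta_t}(\mathbf{x}_t)$, and $\delta_{t+1}=\delta_t/2$. Standing assumptions: (i) $f$ is $L$-smooth for some constant $L>0$; (ii) $f$ is a differentiable Łojasiewicz function with exponent $\theta$; (iii) $\inf_{\mathbf{x}\in\mathbb{R}^n}f(\mathbf{x})>-\infty$; (iv) all critical points of $f$ are isolated; (v) there exists a critical point $\mathbf{x}^*$ of $f$ such that the SZGD sequence satisfies $\|\mathbf{x}_t-\mathbf{x}^*\|\le\mu$ for all $t$, where $\mu$ is the radius in the Łojasiewicz inequality at $\mathbf{x}^*$.
   Formalization: The almost sure convergence is stated under the extra assumption η_+ < 2k/(Ln), already implied in (a) and (b); without it the claim fails: for f(x) = (L/2)‖x‖² and η_t = 2k/(Ln), ‖x_t‖ = ‖x_0‖ for all t. *)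

(* Defs.v *)
(* MathComp world, with MathComp-Analysis *)
From HB Require Import structures.
From mathcomp Require Import all_boot all_order all_algebra finmap.
From mathcomp Require Import all_classical all_reals all_analysis.
Set Implicit Arguments.
Unset Strict Implicit.
Unset Printing Implicit Defensive.
Import Order.TTheory GRing.Theory Num.Theory.
Import numFieldNormedType.Exports.
Local Open Scope classical_set_scope.
Local Open Scope ring_scope.

(* The library norm `|x| on matrices is the sup norm. *)
Definition l2norm (R : realType) (n : nat) (x : 'rV[R]_n) : R :=
  Num.sqrt (\sum_(i < n) x ord0 i ^+ 2).

Definition grad (R : realType) (n : nat) (f : 'rV[R]_n -> R) (x : 'rV[R]_n) :
    'rV[R]_n :=
  \row_(i < n) 'D_(delta_mx ord0 i) f x.

Definition critical (R : realType) (n : nat) (f : 'rV[R]_n -> R)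
    (x : 'rV[R]_n) : Prop :=
  grad f x = 0.

Definition smooth (R : realType) (n : nat) (L : R) (f : 'rV[R]_n -> R) : Prop :=
  [/\ forall x, differentiable f x,
      continuous (grad f) &
      forall x y, l2norm (grad f x - grad f y) <= L * l2norm (x - y)].

Definition lojasiewicz_at (R : realType) (n : nat) (theta : R)
    (f : 'rV[R]_n -> R) (xs : 'rV[R]_n) (kappa mu : R) : Prop :=
  forall x, l2norm (x - xs) <= mu ->
    `|f x - f xs| `^ theta <= kappa * l2norm (grad f x).

Definition lojasiewicz (R : realType) (n : nat) (theta : R)
    (f : 'rV[R]_n -> R) : Prop :=
  (forall x, differentiable f x) /\
  forall xs, critical f xs ->
    exists kappa mu : R,
      [/\ 0 < kappa, 0 < mu & lojasiewicz_at theta f xs kappa mu].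

Definition isolated_critical_points (R : realType) (n : nat)
    (f : 'rV[R]_n -> R) : Prop :=
  forall x, critical f x ->
    exists2 e : R, 0 < e &
      forall y, critical f y -> l2norm (y - x) < e -> y = x.

Definition stiefel (R : realType) (n k : nat) : set 'M[R]_(n, k) :=
  [set X | X^T *m X = 1%:M].

Definition borel_mx (R : realType) (m n : nat) :=
  g_sigma_algebraType (@open 'M[R]_(m, n)).

Definition random_mx (R : realType) (m n : nat) (d : measure_display)
    (T : measurableType d) (X : T -> 'M[R]_(m, n)) : Prop :=
  measurable_fun [set: T] (X : T -> borel_mx R m n).

(* The orthogonal group acts transitively on St(n, k) by left multiplication,
   so the uniform distribution is the unique Borel probability measure on
   St(n, k) that is invariant under this action. *)
Definition uniform_stiefel (R : realType) (n k : nat) (d : measure_display)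
    (T : measurableType d) (P : probability T R) (V : T -> 'M[R]_(n, k)) :
    Prop :=
  [/\ random_mx V,
      {ae P, forall w, stiefel (V w)} &
      forall U : 'M[R]_n, U^T *m U = 1%:M ->
        forall A : set (borel_mx R n k), measurable A ->
          P [set w | A (U *m V w)] = P [set w | A (V w)]].

(* Mutual independence of the whole family, equivalently independence of each
   V t from V 0, ..., V (t - 1). *)
Definition independent_mx (R : realType) (m n : nat) (d : measure_display)
    (T : measurableType d) (P : probability T R) (V : nat -> T -> 'M[R]_(m, n)) :
    Prop :=
  forall (J : {fset nat}) (A : nat -> set (borel_mx R m n)),
    (forall j, measurable (A j)) ->
    P (\bigcap_(j in [set` J]) [set w | A j (V j w)]) =
      (\prod_(j <- J) P [set w | A j (V j w)])%E.

(* Points of R^n are rows, whereas the directions are the columns of V. *)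
Definition grad_estimate (R : realType) (n k : nat) (f : 'rV[R]_n -> R)
    (delta : R) (V : 'M[R]_(n, k)) (x : 'rV[R]_n) : 'rV[R]_n :=
  (n%:R / (2 * delta * k%:R)) *:
    \sum_(i < k) (f (x + delta *: (col i V)^T) - f (x - delta *: (col i V)^T))
                   *: (col i V)^T.

Fixpoint szgd_delta (R : realType) (delta0 : R) (t : nat) : R :=
  if t is t'.+1 then szgd_delta delta0 t' / 2 else delta0.

Fixpoint szgd (R : realType) (n k : nat) (f : 'rV[R]_n -> R) (x0 : 'rV[R]_n)
    (delta0 : R) (eta : nat -> R) (V : nat -> 'M[R]_(n, k)) (t : nat) :
    'rV[R]_n :=
  if t is t'.+1 then
    let x := szgd f x0 delta0 eta V t' in
    x - eta t' *: grad_estimate f (szgd_delta delta0 t') (V t') x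
  else x0.

(* Main.v *)
Require Import Defs.
From HB Require Import structures.
From mathcomp Require Import all_boot all_order all_algebra finmap.
From mathcomp Require Import all_classical all_reals all_analysis.
From mathcomp Require Import measurable_realfun ring lra.
Import Order.TTheory GRing.Theory Num.Theory.
Import numFieldNormedType.Exports.
Local Open Scope classical_set_scope.
Local Open Scope ring_scope.

(** Write [g] for the gradient of [f] at the iterate [x t], [V] for the random
frame, [p = g *m V] for the coordinates of [g] along the frame and [delta] for
the finite-difference radius, which is halved at every step.

Smoothness makes each central difference equal to the corresponding entry of
[p] up to [O(delta)], so the estimate of the gradient is [n / k] times the
projection of [g] on the span of the frame, up to [O(delta)]. The quadratic
upper bound for [f] then gives the deterministic inequality
[f (x t.+1) <= f (x t) - c |p|^2 + C delta] (lemma [szgd_descent]), with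
[c > 0] exactly because the steps stay below [2 k / (L n)]. Since the radii are
summable, [f (x t) + 2 C delta] decreases along every trajectory, [p] tends to
[0] and so do the steps ([trajectory_cvg]).

Convergence. The frame is independent of the iterate and its law is invariant
under the orthogonal group, hence [E |p|^2 = (k / n) E |g|^2]
([expected_projection_indep]). Summing the descent inequality bounds the sum
of the [E |g|^2], so [g] tends to [0] almost surely. A bounded sequence whose
steps tend to [0] and along which the gradient tends to [0] cannot travel
between isolated critical points, so it converges ([slow_cvg_isolated_zero]).
Its limit lies in the ball where the Lojasiewicz inequality at [xs] holds and
the gradient vanishes there, so [f] takes the deterministic value [f xs] at
the limit.

Rates. Let [F] be the gap [f (x t) - f xs] and [q = max 1 (2 theta)]. The
Lojasiewicz inequality and the boundedness of the gap give
[|F| ^ q <= K |g|^2]; by Jensen's inequality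
[(E |F|) ^ q <= K E |g|^2]. Inserted in the mean of the descent inequality,
this shows that [b t = E F + 4 C delta] satisfies
[b t.+1 <= b t - c' (b t) ^ q] ([mean_gap_recursion]) and dominates [|E F|].
For [q = 1] such a sequence decays geometrically and for [q = 1 + s] like
[t ^ (- 1 / s)] ([geometric_decay], [polynomial_decay]). *)

Set Implicit Arguments.
Unset Strict Implicit.
Unset Printing Implicit Defensive.

(** * Euclidean geometry of row vectors *)

Definition dotp (R : realType) (n : nat) (u v : 'rV[R]_n) : R :=
  \sum_(i < n) u ord0 i * v ord0 i.

Section Euclid.
Context {R : realType}.
Implicit Types n : nat.

Lemma dotpE n (u v : 'rV[R]_n) : dotp u v = (u *m v^T) ord0 ord0.
Proof. by rewrite mxE; apply: eq_bigr => i _; rewrite mxE. Qed.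

Lemma dotpC n (u v : 'rV[R]_n) : dotp u v = dotp v u.
Proof. by apply: eq_bigr => i _; rewrite mulrC. Qed.

Lemma dotpDl n (u v w : 'rV[R]_n) : dotp (u + v) w = dotp u w + dotp v w.
Proof. by rewrite !dotpE mulmxDl mxE. Qed.

Lemma dotpZl n a (u w : 'rV[R]_n) : dotp (a *: u) w = a * dotp u w.
Proof. by rewrite !dotpE -scalemxAl mxE. Qed.

Lemma dotpNl n (u w : 'rV[R]_n) : dotp (- u) w = - dotp u w.
Proof. by rewrite -scaleN1r dotpZl mulN1r. Qed.

Lemma dotpDr n (u v w : 'rV[R]_n) : dotp w (u + v) = dotp w u + dotp w v.
Proof. by rewrite dotpC dotpDl !(dotpC w). Qed.

Lemma dotpZr n a (u w : 'rV[R]_n) : dotp w (a *: u) = a * dotp w u.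
Proof. by rewrite dotpC dotpZl (dotpC w). Qed.

Lemma dotpNr n (u w : 'rV[R]_n) : dotp w (- u) = - dotp w u.
Proof. by rewrite dotpC dotpNl (dotpC w). Qed.

Lemma dotp_ge0 n (u : 'rV[R]_n) : 0 <= dotp u u.
Proof. by apply: sumr_ge0 => i _; rewrite -expr2 sqr_ge0. Qed.

Lemma dotp_eq0 n (u : 'rV[R]_n) : dotp u u = 0 -> u = 0.
Proof.
move=> /psumr_eq0P h; apply/rowP => i; rewrite mxE.
have /eqP := h (fun j _ => ltac:(rewrite -expr2; exact: sqr_ge0)) i isT.
by rewrite mulf_eq0 orbb => /eqP.
Qed.

Lemma l2norm_ge0 n (u : 'rV[R]_n) : 0 <= l2norm u.
Proof. exact: sqrtr_ge0. Qed.

Lemma sqr_l2norm n (u : 'rV[R]_n) : l2norm u ^+ 2 = dotp u u.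
Proof.
rewrite sqr_sqrtr; last by apply: sumr_ge0 => i _; exact: sqr_ge0.
by apply: eq_bigr => i _; rewrite expr2.
Qed.

Lemma l2norm0 n : l2norm (0 : 'rV[R]_n) = 0.
Proof.
by rewrite /l2norm big1 ?sqrtr0// => i _; rewrite mxE expr0n.
Qed.

Lemma l2norm_le n (u : 'rV[R]_n) (a : R) :
  0 <= a -> dotp u u <= a ^+ 2 -> l2norm u <= a.
Proof.
by move=> a0 ua; rewrite -(@ler_pXn2r _ 2)// ?nnegrE ?l2norm_ge0// sqr_l2norm.
Qed.

Lemma Cauchy_Schwarz n (u v : 'rV[R]_n) : dotp u v ^+ 2 <= dotp u u * dotp v v.
Proof.
have [v0|v0] := eqVneq (dotp v v) 0.
  by rewrite v0 mulr0 (dotp_eq0 v0) -(scale0r 0) dotpZr mul0r expr0n.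
have vgt0 : 0 < dotp v v by rewrite lt_def v0 dotp_ge0.
(* This vector is [dotp v v] times the component of [u] orthogonal to [v]. *)
have := dotp_ge0 (dotp v v *: u - dotp u v *: v).
rewrite !(dotpDl, dotpDr, dotpNl, dotpNr, dotpZl, dotpZr) (dotpC v u).
move: vgt0; move: (dotp u u) (dotp u v) (dotp v v) => a b c c0.
rewrite (_ : _ + _ = c * (a * c - b ^+ 2)); last by ring.
by rewrite pmulr_rge0// subr_ge0.
Qed.

Lemma dotp_le_l2norm n (u v : 'rV[R]_n) : `|dotp u v| <= l2norm u * l2norm v.
Proof.
rewrite -(@ler_pXn2r _ 2)// ?nnegrE ?mulr_ge0 ?l2norm_ge0//.
by rewrite real_normK ?num_real// exprMn !sqr_l2norm Cauchy_Schwarz.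
Qed.

Lemma l2norm_triangle n (u v : 'rV[R]_n) :
  l2norm (u + v) <= l2norm u + l2norm v.
Proof.
apply: l2norm_le; first by rewrite addr_ge0 ?l2norm_ge0.
rewrite !dotpDl !dotpDr (dotpC v u) sqrrD !sqr_l2norm.
have := le_trans (ler_norm _) (dotp_le_l2norm u v); rewrite -mulr_natl; lra.
Qed.

(** The topology on row vectors is that of the sup norm; this bound and
[l2norm_le_normr] make it interchangeable with the Euclidean one. *)
Lemma normr_le_l2norm n (u : 'rV[R]_n) : `|u| <= l2norm u.
Proof.
rewrite [ `|u| ]/Num.norm/= mx_normrE; apply/bigmax_leP; split; first exact: l2norm_ge0.
move=> [i j] _ /=; rewrite (ord1 i) -(@ler_pXn2r _ 2)// ?nnegrE ?l2norm_ge0//.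
rewrite sqr_l2norm real_normK ?num_real// /dotp (bigD1 j)//= expr2 lerDl.
by apply: sumr_ge0 => k _; rewrite -expr2 sqr_ge0.
Qed.

Lemma coord_le_normr m n (u : 'M[R]_(m, n)) i j : `|u i j| <= `|u|.
Proof.
rewrite [leRHS]/Num.norm/= mx_normrE.
exact: (le_bigmax_cond 0 (fun ij : 'I_m * 'I_n => `|u ij.1 ij.2|) (j := (i, j))).
Qed.

Lemma l2norm_le_normr n (u : 'rV[R]_n) : l2norm u <= Num.sqrt n%:R * `|u|.
Proof.
apply: l2norm_le; first by rewrite mulr_ge0 ?sqrtr_ge0.
rewrite exprMn sqr_sqrtr//.
rewrite [X in _ <= X](_ : _ = \sum_(i < n) `|u| ^+ 2); last first.
  by rewrite sumr_const card_ord mulr_natl.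
apply: ler_sum => i _; rewrite -expr2 -[X in X <= _]real_normK ?num_real//.
by rewrite lerXn2r ?nnegrE// coord_le_normr.
Qed.

End Euclid.

(** * The descent inequality *)

Section Smooth.
Context {R : realType} (n : nat) (f : 'rV[R]_n -> R) (L : R).

Lemma derive_dotp_grad (x h : 'rV[R]_n) : differentiable f x ->
  'D_h f x = dotp (grad f x) h.
Proof.
move=> df; rewrite deriveE// [in LHS](row_sum_delta h) linear_sum.
apply: eq_bigr => i _; rewrite linearZ/= -deriveE// mxE mulrC.
by congr (_ * _).
Qed.

Hypotheses (L0 : 0 <= L) (fL : smooth L f).

(** Along the segment from [x] to [x + h] the derivative of [f] is the inner
product of [h] with the gradient, which moves by at most [L s |h|]; the sign
[s] gives the upper and the lower quadratic bound together. *)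
Lemma smooth_quadratic_sign (s : R) (x h : 'rV[R]_n) : `|s| = 1 ->
  s * (f (x + h) - f x - dotp (grad f x) h) <= L / 2 * dotp h h.
Proof.
move=> s1; case: fL => df _ lip.
pose phi (r : R) := f (x + r *: h).
have phiE (r : R) : is_derive r 1 phi (dotp (grad f (x + r *: h)) h).
  have E : (fun a : R => a^-1 *: ((phi \o shift r) (a *: (1 : R)) - phi r)) =
      (fun a : R => a^-1 *: ((f \o shift (x + r *: h)) (a *: h) - f (x + r *: h))).
    apply/funext => a /=; rewrite /phi; congr (_ *: (f _ - _)).
    by rewrite [a *: 1]mulr1 scalerDl addrCA.
  have dx := @diff_derivable _ _ _ f (x + r *: h) h (df (x + r *: h)).
  apply: DeriveDef; first by rewrite /derivable E; exact: dx.
  by rewrite -derive_dotp_grad// /derive E.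
pose psi (r : R) := s * (phi r - r * dotp (grad f x) h) - L / 2 * r ^+ 2 * dotp h h.
pose dpsi (r : R) :=
  s * (dotp (grad f (x + r *: h)) h - dotp (grad f x) h) - L * r * dotp h h.
have psiE (r : R) : is_derive r 1 psi (dpsi r).
  rewrite /psi /dpsi.
  have -> : (fun r : R => s * (phi r - r * dotp (grad f x) h) -
       L / 2 * r ^+ 2 * dotp h h) =
      s *: (phi - dotp (grad f x) h *: id) - (L / 2 * dotp h h) *: (@GRing.exp R ^~ 2%N).
    apply/funext => t; rewrite !fctE/=.
    by rewrite -![_ *: _]/(_ * _); ring.
  by apply: is_derive_eq; rewrite /GRing.scale/=; field.
have cpsi : {within `[0, 1], continuous psi}.
  apply: continuous_subspaceT => /= t; apply: differentiable_continuous.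
  by apply/derivable1_diffP; exact: (@ex_derive _ _ _ _ _ _ _ (psiE t)).
have [c] := MVT ltr01 (fun r _ => psiE r) cpsi.
rewrite in_itv/= subr0 mulr1 => /andP[c0 c1] E.
have : dpsi c <= 0.
  rewrite /dpsi subr_le0 -dotpNl -dotpDl -sqr_l2norm.
  apply: (le_trans (ler_norm _)); rewrite normrM s1 mul1r.
  apply: (le_trans (dotp_le_l2norm _ _)); rewrite expr2 mulrA.
  apply: ler_wpM2r; first exact: l2norm_ge0.
  apply: (le_trans (lip _ _)); rewrite -mulrA; apply: ler_wpM2l => //.
  rewrite addrC addKr.
  apply: l2norm_le; first by apply: mulr_ge0; [exact: ltW|exact: l2norm_ge0].
  by rewrite dotpZl dotpZr exprMn sqr_l2norm expr2 mulrA.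
rewrite -E /psi /phi scale1r scale0r addr0 mul1r mul0r subr0 expr1n expr0n/=.
rewrite mulr0 mul0r subr0 mulr1; lra.
Qed.

Lemma smooth_upper (x h : 'rV[R]_n) :
  f (x + h) <= f x + dotp (grad f x) h + L / 2 * dotp h h.
Proof.
by have := @smooth_quadratic_sign 1 x h (normr1 _); rewrite mul1r; lra.
Qed.

Lemma smooth_lower (x h : 'rV[R]_n) :
  f x + dotp (grad f x) h - L / 2 * dotp h h <= f (x + h).
Proof.
have := @smooth_quadratic_sign (-1) x h; rewrite normrN1 mulN1r => /(_ erefl).
lra.
Qed.

End Smooth.

(** * One step of the method *)

Section Stiefel.
Context {R : realType} (n k : nat) (V : 'M[R]_(n, k)).
Hypothesis stV : stiefel V.

Lemma dotp_mulmx_tr (g : 'rV[R]_n) (u : 'rV[R]_k) :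
  dotp g (u *m V^T) = dotp (g *m V) u.
Proof. by rewrite !dotpE trmx_mul trmxK mulmxA. Qed.

Lemma stiefel_isometry (u : 'rV[R]_k) : dotp (u *m V^T) (u *m V^T) = dotp u u.
Proof. by rewrite dotp_mulmx_tr -mulmxA stV mulmx1. Qed.

(** Bessel's inequality: [g *m V] lists the coordinates of [g] along the
orthonormal columns of [V]. *)
Lemma stiefel_Bessel (g : 'rV[R]_n) : dotp (g *m V) (g *m V) <= dotp g g.
Proof.
have := dotp_ge0 (g - (g *m V) *m V^T).
rewrite dotpDl !dotpDr !dotpNl !dotpNr stiefel_isometry dotp_mulmx_tr.
by rewrite (dotpC _ g) dotp_mulmx_tr; lra.
Qed.

Lemma stiefel_col_unit i : dotp (col i V)^T (col i V)^T = 1.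
Proof.
have /matrixP/(_ i i) : V^T *m V = 1%:M := stV.
rewrite !mxE eqxx => E; apply: etrans E.
by apply: eq_bigr => j _; rewrite !mxE.
Qed.

Lemma dotp_col (g : 'rV[R]_n) i : dotp g (col i V)^T = (g *m V) ord0 i.
Proof. by rewrite mxE; apply: eq_bigr => j _; rewrite !mxE. Qed.

End Stiefel.

Definition central_diff (R : realType) (n k : nat) (f : 'rV[R]_n -> R)
    (delta : R) (V : 'M[R]_(n, k)) (x : 'rV[R]_n) : 'rV[R]_k :=
  \row_(i < k) ((f (x + delta *: (col i V)^T) - f (x - delta *: (col i V)^T))
                / (2 * delta)).

Lemma grad_estimateE (R : realType) (n k : nat) (f : 'rV[R]_n -> R)
    (delta : R) (V : 'M[R]_(n, k)) (x : 'rV[R]_n) :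
  grad_estimate f delta V x =
  (n%:R / k%:R) *: (central_diff f delta V x *m V^T).
Proof.
rewrite /grad_estimate mulmx_sum_row !scaler_sumr; apply: eq_bigr => i _.
rewrite !scalerA mxE tr_col; congr (_ *: _).
by rewrite invfM; ring.
Qed.

Section Step.
Context {R : realType} (n k : nat) (f : 'rV[R]_n -> R) (L : R).
Hypotheses (L0 : 0 < L) (fL : smooth L f).
Variables (V : 'M[R]_(n, k)) (x : 'rV[R]_n) (delta : R).
Hypotheses (stV : stiefel V) (delta0 : 0 < delta).

Lemma central_diff_error i :
  `|central_diff f delta V x ord0 i - (grad f x *m V) ord0 i| <= L * delta / 2.
Proof.
have hv := stiefel_col_unit stV i.
have := smooth_upper (ltW L0) fL x (delta *: (col i V)^T).
have := smooth_lower (ltW L0) fL x (delta *: (col i V)^T).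
have := smooth_upper (ltW L0) fL x (- (delta *: (col i V)^T)).
have := smooth_lower (ltW L0) fL x (- (delta *: (col i V)^T)).
rewrite !(dotpNl, dotpNr, dotpZl, dotpZr) hv dotp_col [central_diff _ _ _ _ _ _]mxE.
move: (f (x + delta *: (col i V)^T)) (f (x - delta *: (col i V)^T)) (f x)
  ((grad f x *m V) ord0 i) => a b c p h1 h2 h3 h4.
rewrite -(ler_pM2l (_ : 0 < 2 * delta)) ?mulr_gt0//.
rewrite -[X in X * `|_|]ger0_norm ?mulr_ge0 ?(ltW delta0)// -normrM.
have d0 : delta != 0 by rewrite gt_eqF.
rewrite (_ : 2 * delta * _ = a - b - 2 * delta * p); last by field.
by rewrite ler_norml; apply/andP; split; lra.
Qed.

Let eps : R := Num.sqrt k%:R * (L / 2).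

Lemma central_diff_l2error :
  l2norm (central_diff f delta V x - grad f x *m V) <= eps * delta.
Proof.
apply: l2norm_le.
  by rewrite /eps !mulr_ge0 ?sqrtr_ge0 ?invr_ge0 ?(ltW L0) ?(ltW delta0).
rewrite /eps !exprMn sqr_sqrtr//.
rewrite [X in _ <= X](_ : _ = \sum_(i < k) (L * delta / 2) ^+ 2); last first.
  by rewrite sumr_const card_ord -mulr_natl; ring.
apply: ler_sum => i _; rewrite -expr2 -[X in X <= _]real_normK ?num_real//.
rewrite ler_pXn2r ?nnegrE ?mulr_ge0 ?invr_ge0 ?(ltW L0) ?(ltW delta0)//.
by rewrite mxE [X in _ + X]mxE central_diff_error.
Qed.

Variables (eta etam etap G : R).
Hypotheses (etam0 : 0 < etam) (heta : etam <= eta <= etap) (delta1 : delta <= 1).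
Hypothesis (hetap : L * (n%:R / k%:R) * etap <= 2).
Hypothesis (hG : l2norm (grad f x) <= G).

Let a : R := n%:R / k%:R.
Let p := grad f x *m V.
Let x' := x - eta *: grad_estimate f delta V x.

Let e := central_diff f delta V x - p.

Let bound_cross : `|dotp p e| <= G * (eps * delta).
Proof.
apply: (le_trans (dotp_le_l2norm _ _)); apply: ler_pM; rewrite ?l2norm_ge0//.
  rewrite (le_trans _ hG)// l2norm_le ?l2norm_ge0// sqr_l2norm.
  exact: stiefel_Bessel.
exact: central_diff_l2error.
Qed.

Let bound_err : dotp e e <= eps ^+ 2 * delta.
Proof.
have eps0 : 0 <= eps * delta.
  by rewrite !mulr_ge0 ?sqrtr_ge0 ?invr_ge0 ?(ltW L0) ?(ltW delta0).
apply: (@le_trans _ _ ((eps * delta) ^+ 2)).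
  rewrite -sqr_l2norm ler_pXn2r ?nnegrE ?l2norm_ge0//.
  exact: central_diff_l2error.
rewrite exprMn ler_wpM2l ?sqr_ge0// expr2 ler_piMr ?(ltW delta0)//.
Qed.

Let a0 : 0 <= a. Proof. by rewrite divr_ge0. Qed.

Let step_eq : x' = x + - (eta * a) *: ((p + e) *m V^T).
Proof.
have -> : p + e = central_diff f delta V x by rewrite /e addrC subrK.
by rewrite /x' grad_estimateE scaleNr scalerA.
Qed.

(** To first order the step goes along the projection of [- grad f x] on the
span of the frame, so it decreases [f] by a multiple of [dotp p p]; the finite
differences perturb this by [O(delta)], using [|p| <= G] for the cross term. *)
Lemma szgd_descent :
  f x' <= f x - a * etam * (1 - L * a * etap / 2) * dotp p p
        + ((etap * a + L * (etap * a) ^+ 2) * G * eps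
           + L / 2 * (etap * a) ^+ 2 * eps ^+ 2) * delta.
Proof.
rewrite step_eq; apply: (le_trans (smooth_upper (ltW L0) fL _ _)).
rewrite !(dotpZr, dotpZl) stiefel_isometry// dotp_mulmx_tr -/p.
move: bound_cross bound_err; move: (e) => r.
rewrite !dotpDr !dotpDl (dotpC r p); move: (dotp_ge0 p) (dotp_ge0 r).
move: (dotp p p) (dotp p r) (dotp r r) => P X E P0 E0 hX hE.
move/andP: heta => [h1 h2].
have b0 : 0 <= eta * a by rewrite mulr_ge0// ltW// (lt_le_trans etam0).
have b1 : eta * a <= etap * a by rewrite ler_wpM2r.
have bsq : (eta * a) ^+ 2 <= (etap * a) ^+ 2.
  by rewrite ler_pXn2r// nnegrE (le_trans b0).
(* [b - L b^2 / 2 = b (1 - L b / 2)] is smallest when its two factors are. *)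
have main : a * etam * (1 - L * a * etap / 2) * P <=
    (eta * a - L / 2 * (eta * a) ^+ 2) * P.
  apply: ler_wpM2r => //.
  rewrite (_ : eta * a - _ = (a * eta) * (1 - L * a * eta / 2)); last by ring.
  apply: ler_pM.
  - by rewrite mulr_ge0// ltW.
  - by move: hetap; rewrite -/a; lra.
  - by rewrite ler_wpM2l.
  - have : L * a * eta <= L * a * etap by rewrite ler_wpM2l// mulr_ge0// ltW.
    by lra.
have cross : (- (eta * a) + L * (eta * a) ^+ 2) * X <=
    (etap * a + L * (etap * a) ^+ 2) * (G * (eps * delta)).
  apply: (le_trans (ler_norm _)); rewrite normrM; apply: ler_pM => //.
  apply: (le_trans (ler_normD _ _)); rewrite normrN; apply: lerD.
    by rewrite ger0_norm.
  rewrite ger0_norm; last by rewrite mulr_ge0 ?sqr_ge0// ltW.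
  by rewrite ler_wpM2l// ltW.
have err : L / 2 * (eta * a) ^+ 2 * E <= L / 2 * (etap * a) ^+ 2 * (eps ^+ 2 * delta).
  have L20 : 0 <= L / 2 by rewrite divr_ge0// ltW.
  apply: ler_pM => //; first by rewrite mulr_ge0 ?sqr_ge0.
  by rewrite ler_wpM2l.
by move: main cross err; lra.
Qed.

Lemma szgd_step_small :
  l2norm (x' - x) ^+ 2 <= 2 * (etap * a) ^+ 2 * (dotp p p + eps ^+ 2 * delta).
Proof.
rewrite step_eq (addrC x) addrK sqr_l2norm !(dotpZr, dotpZl) stiefel_isometry//.
have pe : dotp (p + e) (p + e) <= 2 * (dotp p p + eps ^+ 2 * delta).
  move: bound_err; move: (e) => r; have := dotp_ge0 (p - r).
  by rewrite !dotpDr !dotpDl !dotpNl !dotpNr (dotpC r p); lra.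
rewrite (_ : - (eta * a) * _ = (eta * a) ^+ 2 * dotp (p + e) (p + e)); last by ring.
rewrite (_ : 2 * (etap * a) ^+ 2 * _ =
  (etap * a) ^+ 2 * (2 * (dotp p p + eps ^+ 2 * delta))); last by ring.
move/andP: heta => [h1 h2].
have b0 : 0 <= eta * a by rewrite mulr_ge0// ltW// (lt_le_trans etam0).
have b1 : eta * a <= etap * a by rewrite ler_wpM2r.
apply: ler_pM => //; rewrite ?sqr_ge0 ?dotp_ge0//.
by rewrite ler_pXn2r// nnegrE (le_trans b0).
Qed.

End Step.

(** * Convergence to an isolated zero *)

Lemma continuous_dist (R : realType) n (l : 'rV[R]_n) :
  continuous (fun v : 'rV[R]_n => `|v - l|).
Proof.
have h : continuous ((fun v : 'rV[R]_n => v - l) : 'rV[R]_n -> 'rV[R]_n).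
  move=> /= v; apply: (@continuousB R 'rV[R]_n 'rV[R]_n id (cst l) v).
    exact: cvg_id.
  exact: cst_continuous.
by move=> v; apply: (@cvg_norm _ 'rV[R]_n _ (nbhs v) _ _ _ (h v)).
Qed.

Section IsolatedZero.
Context {R : realType} (n : nat) (u : nat -> 'rV[R]_n) (g : 'rV[R]_n -> R) (M : R).
Hypotheses (gcont : continuous g) (ubd : forall t, `|u t| <= M).
Hypothesis ustep : (fun t => u t.+1 - u t) @ \oo --> (0 : 'rV[R]_n).
Hypothesis gu0 : (g (u t)) @[t --> \oo] --> (0 : R).
Hypothesis giso : forall y, g y = 0 ->
  exists2 e : R, 0 < e & forall z, g z = 0 -> `|z - y| < e -> z = y.

Let cluster_point : exists l, cluster (u @ \oo) l.
Proof.
have cK : compact [set v : 'rV[R]_n | `|v| <= M].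
  apply: bounded_closed_compact.
    by exists M; split; [exact: num_real|move=> y My v /= /le_trans; apply; exact: ltW].
  rewrite (_ : [set _ | _] = (fun v : 'rV[R]_n => `|v|) @^-1` [set y : R | y <= M])//.
  apply: (@closed_comp _ _ (fun v : 'rV[R]_n => `|v|)); last exact: closed_le.
  by move=> ? _; exact: norm_continuous.
have [|l [_ lcl]] := cK (u @ \oo) _; last by exists l.
by exists 0%N => // t _ /=; exact: ubd.
Qed.

Let frequently l (lcl : cluster (u @ \oo) l) (N : nat) (r : R) : 0 < r ->
  exists2 t, (N <= t)%N & `|u t - l| < r.
Proof.
move=> r0.
have [|_ [[t Nt <-] h]] := lcl (u @` [set t | (N <= t)%N]) (ball l r) _ (nbhsx_ballx _ _ r0).
  by exists N => // t Nt /=; exists t.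
by exists t => //; move: h; rewrite -ball_normE/= distrC.
Qed.

Let cluster_zero l (lcl : cluster (u @ \oo) l) : g l = 0.
Proof.
apply/eqP; apply: contrapT => /negP gl0.
have gl : 0 < `|g l| / 2 by rewrite divr_gt0// normr_gt0.
have [e /= e0 he] : exists2 e, 0 < e & forall v, `|v - l| < e -> `|g v - g l| < `|g l| / 2.
  have /cvgrPdist_lt/(_ _ gl) := @gcont l.
  move=> /nbhs_ballP[e /= e0 he]; exists e => // v vl.
  by rewrite distrC; apply: he; rewrite -ball_normE/= distrC.
have /cvgrPdist_lt/(_ _ gl)[N _ hN] := gu0.
have [t Nt /he ht] := frequently lcl N e0.
have := hN t Nt; rewrite sub0r normrN.
have := ler_normB (g (u t)) (g (u t) - g l); rewrite subKr; lra.
Qed.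

(** The limit point [l] is surrounded by thin shells on which [g] is bounded
away from [0]; once the steps are shorter than the width of a shell and [g]
is small along the sequence, the sequence can no longer leave. *)
Lemma slow_cvg_isolated_zero : exists l, u @ \oo --> l /\ g l = 0.
Proof.
have [l lcl] := cluster_point; have gl0 := cluster_zero lcl.
exists l; split => //; have [e e0 he] := giso gl0.
apply/cvgrPdist_lt => r0 r0gt.
pose r := Num.min (r0 / 2) (e / 2).
have rgt : 0 < r by rewrite lt_min !divr_gt0.
have rr0 : r < r0 by rewrite gt_min; apply/orP; left; lra.
have re : r < e by rewrite gt_min; apply/orP; right; lra.
pose A := [set v : 'rV[R]_n | r / 2 <= `|v - l| <= r].
(* The shell [A] is compact, so [g] has a nonzero minimum modulus on it. *)
have [N1 _ hN1] : \forall t \near \oo, ~ A (u t).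
  have [A0|/set0P/negP/negbNE/eqP A0] := pselect (A !=set0); last first.
    by near=> t; rewrite A0.
  have cA : compact A.
    apply: bounded_closed_compact.
      exists (`|l| + r); split; [exact: num_real|move=> y My v /= /andP[_ vl]].
      rewrite (le_trans _ (ltW My))// -[v](subrK l) (le_trans (ler_normD _ _))//.
      by rewrite addrC lerD2l.
    rewrite (_ : A = (fun v : 'rV[R]_n => `|v - l|) @^-1` `[r / 2, r]); last first.
      by apply/seteqP; split => v /=; rewrite in_itv.
    have cd := @continuous_dist R n l.
    by apply: closed_comp => [v _|]; [exact: cd|exact: interval_closed].
  have cg : {within A, continuous (fun v => `|g v|)}.
    apply: continuous_subspaceT => v.
    by apply: continuous_comp; [exact: gcont|exact: norm_continuous].
  have [c /set_mem /= /andP[c1 c2] hc] := compact_EVT_min A0 cA cg.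
  have gc : 0 < `|g c|.
    rewrite normr_gt0; apply/eqP => /he/(_ (le_lt_trans c2 re)) cl.
    by move: c1; rewrite cl subrr normr0; lra.
  have /cvgrPdist_lt/(_ _ gc) := gu0; apply: filterS => t /=.
  by rewrite sub0r normrN ltNge => /negP ht At; apply/ht/hc/mem_set.
have r2 : 0 < r / 2 by rewrite divr_gt0.
have /cvgrPdist_lt/(_ _ r2)[N2 _ hN2] := ustep.
have [T NT uT] := frequently lcl (maxn N1 N2) r2.
exists T => // t /= Tt; rewrite distrC; apply: lt_trans rr0.
suff: `|u t - l| < r / 2 by lra.
move: Tt NT; rewrite geq_max => /subnK <- /andP[T1 T2]; elim: (t - T)%N => // s ih.
have := hN1 (s.+1 + T)%N; rewrite /= (leq_trans T1) ?leq_addl// => /(_ isT)/negP.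
rewrite negb_and -!ltNge => /orP[//|]; rewrite ltNge => /negP[].
have := hN2 (s + T)%N; rewrite /= (leq_trans T2) ?leq_addl// => /(_ isT).
rewrite sub0r normrN addSn => h.
rewrite -(subrK (u (s + T)%N) (u (s + T).+1)) -addrA (le_trans (ler_normD _ _))//.
by lra.
Unshelve. all: by end_near.
Qed.

End IsolatedZero.

(** * Power inequalities and the decay of scalar recursions *)

Section Powers.
Context {R : realType}.
Implicit Types (x y m p s c : R).

(** Young's inequality for [x / m] and [1]. Integrated, with [m] the mean of
[x], it is Jensen's inequality for the power [p]. *)
Lemma powR_tangent x m p : 0 <= x -> 0 < m -> 1 <= p ->
  m `^ p + p * m `^ (p - 1) * (x - m) <= x `^ p.
Proof.
move=> x0 m0; rewrite le_eqVlt => /predU1P[<-|p1].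
  by rewrite subrr powRr0 !powRr1// ?(ltW m0)//; lra.
have p0 : 0 < p by lra.
have r0 : 0 <= x / m by rewrite divr_ge0// ltW.
have pq : p^-1 + (p / (p - 1))^-1 = 1 by field; lra.
have := conjugate_powR r0 ler01 p0 (divr_gt0 p0 (ltac:(lra) : 0 < p - 1)) pq.
rewrite mulr1 powR1 => h.
have {}h : 1 + p * (x / m - 1) <= (x / m) `^ p.
  rewrite -(ler_pM2l p0) in h.
  have E : p * ((x / m) `^ p / p + 1 / (p / (p - 1))) = (x / m) `^ p + p - 1.
    by field; lra.
  by move: h; rewrite E; lra.
have mp : 0 <= m `^ p by exact: powR_ge0.
have := ler_wpM2l mp h; rewrite -powRM ?(ltW m0)// mulrCA mulfV ?gt_eqF// mulr1.
rewrite -(mulr_powRB1 (ltW m0) p0); apply: le_trans.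
by rewrite le_eqVlt; apply/orP; left; apply/eqP; field; rewrite gt_eqF.
Qed.

Lemma powR_add_le x y p : 0 <= x -> 0 <= y -> 0 <= p ->
  (x + y) `^ p <= 2 `^ p * (x `^ p + y `^ p).
Proof.
move=> x0 y0 p0; wlog xy : x y x0 y0 / x <= y.
  move=> h; have [xy|/ltW yx] := leP x y; first exact: h.
  by rewrite addrC (addrC (x `^ p)) h.
apply: (@le_trans _ _ ((2 * y) `^ p)).
  by rewrite ge0_ler_powR ?nnegrE ?addr_ge0 ?mulr_ge0//; lra.
by rewrite powRM// ler_wpM2l ?powR_ge0// lerDr powR_ge0.
Qed.

(** Both exponent regimes reduce to the single power [max 1 (2 theta)]: for
[2 theta < 1] the boundedness of [F] trades [F] against [F `^ (2 theta)]. *)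
Lemma Lojasiewicz_power (theta kappa M F g : R) :
  0 < theta -> 0 <= F -> F <= M -> F `^ theta <= kappa * g ->
  F `^ Num.max 1 (2 * theta) <=
    kappa ^+ 2 * Num.max 1 (M `^ (1 - 2 * theta)) * g ^+ 2.
Proof.
move=> th0 F0 FM Fg.
have sq : F `^ (2 * theta) <= kappa ^+ 2 * g ^+ 2.
  rewrite mulrC powRrM powR_mulrn ?powR_ge0// -exprMn.
  have kg0 : 0 <= kappa * g by rewrite (le_trans _ Fg)// powR_ge0.
  by rewrite ler_pXn2r// nnegrE powR_ge0.
have kg : 0 <= kappa ^+ 2 * g ^+ 2 by rewrite mulr_ge0// sqr_ge0.
rewrite mulrAC; have [th|th] := leP 1 (2 * theta).
  apply: (le_trans sq); rewrite -[X in X <= _]mulr1 ler_wpM2l//.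
  by rewrite le_max lexx.
have -> : F `^ 1 = F `^ (2 * theta) * F `^ (1 - 2 * theta).
  rewrite -powRD; first by congr (_ `^ _); ring.
  by apply/implyP; rewrite addrC subrK oner_eq0.
apply: ler_pM; rewrite ?powR_ge0// le_max; apply/orP; right.
by rewrite ge0_ler_powR// ?nnegrE//; lra.
Qed.

End Powers.

Section Recursion.
Context {R : realType}.
Implicit Types (a b delta : nat -> R) (c p s : R).

(** The spare decrease [C * delta t] pays for replacing [a] by [b] in the power:
[b <= a + 4 C delta] gives [b `^ p <= 2 `^ p * (a `^ p + (4 C) `^ p * delta)],
because [delta `^ p <= delta]. *)
Lemma perturbed_recursion a b delta (C c p : R) : 0 < C -> 0 < c -> 1 <= p ->
  (forall t, 0 < delta t <= 1) -> (forall t, 0 <= a t) -> (forall t, 0 <= b t) ->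
  (forall t, b t <= a t + 4 * C * delta t) ->
  (forall t, b t.+1 <= b t - c * a t `^ p - C * delta t) ->
  exists2 c', 0 < c' & forall t, b t.+1 <= b t - c' * b t `^ p.
Proof.
move=> C0 c0 p1 hd a0 b0 ba hb.
have P2 : 0 < (2 : R) `^ p by rewrite powR_gt0.
have P4 : 0 < (4 * C) `^ p by rewrite powR_gt0// mulr_gt0.
exists (Num.min (c / 2 `^ p) (C / (2 `^ p * (4 * C) `^ p))).
  by rewrite lt_min !divr_gt0// mulr_gt0.
move=> t; apply: (le_trans (hb t)).
rewrite -addrA lerD2l -opprD lerN2.
have /andP[d0 d1] := hd t.
set c' := Num.min _ _.
have c'0 : 0 <= c'.
  by rewrite le_min !divr_ge0 ?mulr_ge0 ?(ltW P2) ?(ltW P4) ?(ltW c0) ?(ltW C0).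
have bp : b t `^ p <= 2 `^ p * (a t `^ p + (4 * C) `^ p * delta t).
  apply: (@le_trans _ _ ((a t + 4 * C * delta t) `^ p)).
    rewrite ge0_ler_powR ?nnegrE//; first lra.
    by rewrite addr_ge0// !mulr_ge0// ltW.
  apply: (le_trans (powR_add_le _ _ _)) => //; [by rewrite !mulr_ge0// ltW|lra|].
  rewrite ler_wpM2l ?(ltW P2)// lerD2l powRM ?mulr_ge0 ?(ltW C0) ?(ltW d0)//.
  by rewrite ler_wpM2l ?(ltW P4)// ge1r_powR// d0.
apply: (le_trans (ler_wpM2l c'0 bp)); rewrite mulrDr mulrDr; apply: lerD.
  rewrite mulrA ler_wpM2r ?powR_ge0// -ler_pdivlMr//.
  by rewrite /c' ge_min lexx.
rewrite !mulrA ler_wpM2r ?(ltW d0)// -mulrA -ler_pdivlMr ?mulr_gt0//.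
by rewrite /c' ge_min lexx orbT.
Qed.

(** A rate above [1/2] is lowered to [1/2], which keeps the ratio positive. *)
Lemma geometric_decay b c : 0 < c -> (forall t, 0 <= b t) ->
  (forall t, b t.+1 <= b t - c * b t) ->
  exists2 q, 0 < q < 1 & forall t, b t <= b 0%N * q ^+ t.
Proof.
move=> c0 b0 hb; pose m := Num.min c 2^-1.
have mc : m <= c by rewrite ge_min lexx.
have m2 : m <= 2^-1 by rewrite ge_min lexx orbT.
have m0 : 0 < m by rewrite lt_min c0 invr_gt0 ltr0n.
exists (1 - m); first lra.
elim=> [|t ih]; first by rewrite expr0 mulr1.
apply: (le_trans (hb t)); rewrite exprS mulrCA.
apply: (@le_trans _ _ ((1 - m) * b t)); last by rewrite ler_wpM2l//; lra.
have := ler_wpM2r (b0 t) mc; lra.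
Qed.

Lemma dominated_geometric_cvg0 (m b : nat -> R) :
  (forall t, `|m t| <= b t) ->
  (exists2 c', 0 < c' & forall t, b t.+1 <= b t - c' * b t) ->
  exists2 Q : R, 1 < Q & (fun t => (Q ^+ t * m t)%:E) @ \oo --> (0 : \bar R)%E.
Proof.
move=> mb [c' c'0 hb].
have b0 t : 0 <= b t by rewrite (le_trans _ (mb t)).
have [q /andP[q0 q1] bq] := geometric_decay c'0 b0 hb.
(* The product of this [Q] with [q] is [(1 + q) / 2 < 1]. *)
exists ((1 + q) / (2 * q)); first by rewrite ltr_pdivlMr ?mulr_gt0//; lra.
apply: cvg_EFin; first exact: nearW.
have r1 : `|(1 + q) / 2| < 1 by rewrite ger0_norm; lra.
apply/norm_cvg0P; apply: (squeeze_cvgr _ (cvg_cst 0) (cvg_geometric (b 0%N) r1)).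
apply: nearW => t /=; rewrite normr_ge0/= normrM ger0_norm; last first.
  by rewrite exprn_ge0// divr_ge0//; lra.
apply: (@le_trans _ _ (((1 + q) / (2 * q)) ^+ t * (b 0%N * q ^+ t))).
  rewrite ler_wpM2l ?(le_trans (mb t))// exprn_ge0// divr_ge0//; lra.
have -> : (1 + q) / 2 = (1 + q) / (2 * q) * q by field; lra.
by rewrite [in leRHS]exprMn mulrCA.
Qed.

(** The recursion reads [b t.+1 <= b t * (1 - w)] with [w = c * b t `^ s], and
[(1 - w) `^ (- s) >= 1 + s * w]; so [b t `^ (- s)] grows by at least [s * c] at
each step, as long as [b] has not reached [0]. *)
Lemma polynomial_decay b c s : 0 < c -> 0 < s -> (forall t, 0 <= b t) ->
  (forall t, b t.+1 <= b t - c * b t `^ (1 + s)) ->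
  forall t, (0 < t)%N -> b t <= (s * c) `^ (- s^-1) * t%:R `^ (- s^-1).
Proof.
move=> c0 s0 b0 hb.
have bm t : b t.+1 <= b t.
  by apply: (le_trans (hb t)); rewrite lerBlDr lerDl mulr_ge0 ?powR_ge0// ltW.
have inv t : 0 < b t -> s * c * t%:R <= b t `^ (- s).
  elim: t => [|t ih] bt; first by rewrite mulr0 powR_ge0.
  have bt0 : 0 < b t by rewrite (lt_le_trans bt)// bm.
  pose w := c * b t `^ s.
  have hw : b t.+1 <= b t * (1 - w).
    have E : b t `^ (1 + s) = b t * b t `^ s.
      by rewrite powRD ?powRr1 ?(ltW bt0)//; apply/implyP; rewrite (gt_eqF bt0).
    by have := hb t; rewrite E /w; lra.
  have w1 : 0 < 1 - w.
    by rewrite -(pmulr_rgt0 _ bt0) (lt_le_trans bt).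
  have : b t `^ (- s) * (1 + s * w) <= b t.+1 `^ (- s).
    rewrite /powR !gt_eqF//.
    apply: (@le_trans _ _ (expR (- s * ln (b t)) * expR (s * w))).
      by rewrite ler_wpM2l ?expR_ge0// expR_ge1Dx.
    rewrite -expRD ler_expR.
    have h1 : ln (b t.+1) <= ln (b t) + ln (1 - w).
      by rewrite -lnM ?posrE// ler_ln ?posrE ?mulr_gt0.
    have h2 : ln (1 - w) <= - w by apply: le_ln1Dx; lra.
    have : s * ln (b t.+1) <= s * (ln (b t) - w) by rewrite ler_wpM2l ?(ltW s0)//; lra.
    lra.
  apply: le_trans; rewrite mulrDr mulr1 /w.
  have -> : b t `^ (- s) * (s * (c * b t `^ s)) = s * c.
    have : b t `^ s != 0 by rewrite powR_eq0 gt_eqF.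
    by rewrite powRN; move: (_ `^ s) => y y0; field.
  by rewrite -natr1 mulrDr mulr1 lerD2r ih.
move=> t t0; have := b0 t; rewrite le_eqVlt => /predU1P[<-|bt].
  by rewrite mulr_ge0// powR_ge0.
have tR : 0 < (t%:R : R) by rewrite ltr0n.
rewrite -powRM ?mulr_ge0 ?(ltW s0) ?(ltW c0)//.
have := inv _ bt; rewrite powRN => h.
have sct : 0 < s * c * t%:R by rewrite !mulr_gt0.
have {}h : b t `^ s <= (s * c * t%:R)^-1.
  by rewrite -[leLHS]invrK lef_pV2 ?posrE ?invr_gt0 ?powR_gt0.
have -> : b t = (b t `^ s) `^ s^-1.
  by rewrite -powRrM mulfV ?gt_eqF// powRr1.
rewrite -[- s^-1]mulN1r powRrM powR_inv1 ?(ltW sct)//.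
by rewrite ge0_ler_powR ?nnegrE ?powR_ge0 ?invr_ge0 ?(ltW s0) ?(ltW sct).
Qed.

End Recursion.

(** * Measurability of random matrices *)

Section RandomMatrix.
Context {R : realType} (d : measure_display) (T : measurableType d).

Lemma continuous_measurable_borel_mx m n (h : 'M[R]_(m, n) -> R) :
  continuous h -> measurable_fun setT (h : borel_mx R m n -> R).
Proof.
move=> ch; apply: (measurability _ (RGenOInfty.measurableE R)).
move=> _ [_ [x ->] <-]; rewrite setTI; apply: sub_sigma_algebra.
by apply: open_comp => [y _|]; [exact: ch|exact: interval_open].
Qed.

Lemma random_mx_comp m n (X : T -> 'M[R]_(m, n)) (h : 'M[R]_(m, n) -> R) :
  random_mx X -> continuous h -> measurable_fun setT (fun w => h (X w)).
Proof.
by move=> mX ch; exact: (measurableT_comp (continuous_measurable_borel_mx ch) mX).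
Qed.

Lemma random_mx_coord m n (X : T -> 'M[R]_(m, n)) i j :
  random_mx X -> measurable_fun setT (fun w => X w i j).
Proof. by move=> mX; apply: (random_mx_comp mX (@coord_continuous _ _ _ i j)). Qed.

(** Matrices with rational entries are countable and dense, so an open set is a
countable union of cubes, and the preimage of a cube only involves entries. *)
Lemma coord_random_mx m n (X : T -> 'M[R]_(m, n)) :
  (forall i j, measurable_fun setT (fun w => X w i j)) -> random_mx X.
Proof.
move=> mX; apply: (@measurability _ _ _ (borel_mx R m n) _ _ open erefl).
move=> _ [A oA <-]; rewrite setTI.
pose cube (q : 'M[rat]_(m, n) * nat) : set 'M[R]_(m, n) :=
  [set x | forall i j, `|ratr (q.1 i j) - x i j| < q.2.+1%:R^-1].
pose F q := if `[< cube q `<=` A >] then X @^-1` cube q else set0.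
have -> : X @^-1` A = \bigcup_q F q.
  apply/seteqP; split => w /=; last first.
    by move=> [q _]; rewrite /F; case: asboolP => // + h; apply.
  move=> Aw; have /nbhs_ballP[e /= e0 eA] : nbhs (X w) A by exact: open_nbhs_nbhs.
  have [N hN] : exists N : nat, N.+1%:R^-1 < e / 2.
    have e2 : 0 < e / 2 by rewrite divr_gt0.
    exists (Num.trunc (e / 2)^-1); rewrite invf_plt ?posrE//.
    by rewrite truncnS_gt.
  have /choice[q hq] : forall ij : 'I_m * 'I_n, exists r : rat,
      `|ratr r - X w ij.1 ij.2| < N.+1%:R^-1.
    move=> ij; have : X w ij.1 ij.2 - N.+1%:R^-1 < X w ij.1 ij.2 + N.+1%:R^-1.
      by rewrite ltrD2l gt0_cp// invr_gt0.
    move=> /rat_in_itvoo[r]; rewrite in_itv/= => /andP[r1 r2]; exists r.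
    by rewrite ltr_distl r1 r2.
  pose Q : 'M[rat]_(m, n) := \matrix_(i, j) q (i, j).
  have wQ : cube (Q, N) (X w) by move=> i j /=; rewrite mxE; exact: (hq (i, j)).
  exists (Q, N) => //; rewrite /F asboolT// => y yQ; apply: eA; split => // i j.
  have := wQ i j; have := yQ i j => /= h1 h2.
  rewrite -ball_normE/= (_ : _ - _ = (ratr (Q i j) - y i j) - (ratr (Q i j) - X w i j)).
    rewrite (le_lt_trans (ler_normB _ _))//; move: hN h1 h2.
    by move: (N.+1%:R^-1) `|_| `|_| => *; lra.
  by ring.
apply: countable_bigcupT_measurable => [|q]; first exact: countableP.
rewrite /F; case: asboolP => // _.
rewrite (_ : _ @^-1` _ = \bigcap_(ij in [set: 'I_m * 'I_n])
   (fun w => X w ij.1 ij.2) @^-1` [set x | `|ratr (q.1 ij.1 ij.2) - x| < q.2.+1%:R^-1]).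
  apply: fin_bigcap_measurable => // ij _; rewrite -[X in measurable X]setTI.
  apply: mX => //; rewrite (_ : [set _ | _] = ball (ratr (q.1 ij.1 ij.2) : R) q.2.+1%:R^-1).
    exact: open_measurable (ball_open _ _).
  by rewrite -ball_normE.
by apply/seteqP; split => w /= h; [move=> [i j] _; exact: h|move=> i j; exact: (h (i, j))].
Qed.

Variables (n k : nat) (f : 'rV[R]_n -> R) (x0 : 'rV[R]_n) (delta0 : R)
  (eta : nat -> R).

Lemma szgd_random_mx (V : nat -> T -> 'M[R]_(n, k)) t :
  continuous f -> (forall s, (s < t)%N -> random_mx (V s)) ->
  random_mx (fun w => szgd f x0 delta0 eta (fun s => V s w) t).
Proof.
move=> cf; elim: t => [|t ih] mV /=; first exact: measurable_cst.
have {}ih := ih (fun s st => mV s (ltnW st)).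
have mVt := mV t (ltnSn t).
apply: coord_random_mx => i j.
pose x w := szgd f x0 delta0 eta (fun s => V s w) t.
have mp (c : R) l : measurable_fun setT (fun w => f (x w + c *: (col l (V t w))^T)).
  apply: random_mx_comp cf; apply: coord_random_mx => i' j'.
  under eq_fun do rewrite !mxE.
  apply: measurable_funD; first exact: random_mx_coord.
  by apply: measurable_funM; [exact: measurable_cst|exact: random_mx_coord].
pose g w := x w i j - eta t * (n%:R / (2 * szgd_delta delta0 t * k%:R) *
  \sum_(l < k) (f (x w + szgd_delta delta0 t *: (col l (V t w))^T)
              - f (x w + (- szgd_delta delta0 t) *: (col l (V t w))^T)) * V t w j l).
rewrite [X in measurable_fun _ X](_ : _ = g).
  apply: measurable_funB; first exact: random_mx_coord.
  apply: measurable_funM; first exact: measurable_cst.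
  apply: measurable_funM; first exact: measurable_cst.
  apply: measurable_sum => l; apply: measurable_funM; last exact: random_mx_coord.
  by apply: measurable_funB; exact: mp.
apply/funext => w; rewrite /g /grad_estimate !mxE summxE.
congr (_ - _ * (_ * _)); apply: eq_bigr => l _.
by rewrite !mxE scaleNr.
Qed.

End RandomMatrix.

(** The entrywise upper limit is measurable whether or not the sequence
converges, and agrees with the limit where it does. *)
Lemma random_mx_limit (R : realType) (d : measure_display) (T : measurableType d)
    m n (Y : nat -> T -> 'M[R]_(m, n)) : (forall t, random_mx (Y t)) ->
  exists2 Yoo : T -> 'M[R]_(m, n), random_mx Yoo &
    forall w l, Y t w @[t --> \oo] --> l -> Yoo w = l.
Proof.
move=> mY; exists (fun w => \matrix_(i, j) fine (limn_esup (fun t => (Y t w i j)%:E))).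
  apply: coord_random_mx => i j; under eq_fun do rewrite mxE.
  apply: measurableT_comp => //; apply: measurable_fun_limn_esup => t.
  by apply/measurable_EFinP; exact: random_mx_coord.
move=> w l Yl; apply/matrixP => i j; rewrite mxE.
have Yij : (Y t w i j)%:E @[t --> \oo] --> (l i j)%:E.
  apply: cvg_EFin; first exact: nearW.
  exact: (cvg_comp _ _ Yl (@coord_continuous _ _ _ i j l)).
by rewrite is_cvg_limn_esupE; [rewrite (cvg_lim _ Yij)|apply/cvg_ex; exists (l i j)%:E].
Qed.

(** * Uniform directions *)

Section Householder.
Context {R : realType} (n : nat).
Implicit Types g h : 'rV[R]_n.

(** The reflection exchanging [g] and [h]. *)
Lemma orthogonal_transitive g h : dotp g g = dotp h h ->
  exists2 U : 'M[R]_n, U^T *m U = 1%:M & g *m U = h.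
Proof.
move=> gh; have [->|ngh] := eqVneq g h.
  by exists 1%:M; rewrite ?mulmx1 ?trmx1.
pose w := g - h.
have w0 : dotp w w != 0.
  by apply: contra ngh => /eqP/dotp_eq0/eqP; rewrite subr_eq0.
have wwE : w *m w^T = (dotp w w)%:M.
  by rewrite [LHS]mx11_scalar dotpE.
have gwE : g *m w^T = (dotp w w / 2)%:M.
  rewrite [LHS]mx11_scalar -dotpE; congr (_%:M).
  rewrite /w !(dotpDl, dotpDr, dotpNl, dotpNr) -gh (dotpC h g).
  by field.
pose a := 2 / dotp w w.
exists (1%:M - a *: (w^T *m w)).
  have -> : (1%:M - a *: (w^T *m w))^T = 1%:M - a *: (w^T *m w).
    by apply/matrixP => i j; rewrite !mxE (eq_sym j) !big_ord1 !mxE; ring.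
  set Y := w^T *m w.
  have YY : (a *: Y) *m (a *: Y) = (a * a * dotp w w) *: Y.
    rewrite -scalemxAl -scalemxAr scalerA -[RHS]scalerA; congr (_ *: _).
    by rewrite /Y mulmxA -(mulmxA w^T) wwE mul_mx_scalar -scalemxAl.
  have aa : a * a * dotp w w = a + a by rewrite /a; field.
  rewrite mulmxBl !mulmxBr !mul1mx mulmx1 YY aa scalerDl.
  by rewrite opprB addrK subrK.
rewrite mulmxBr mulmx1 -scalemxAr mulmxA gwE mul_scalar_mx scalerA.
rewrite (_ : a * _ = 1) ?scale1r /w ?subKr//.
by rewrite /a; field.
Qed.

End Householder.

Section Uniform.
Context {R : realType} (d : measure_display) (Omega : measurableType d).
Context (P : probability Omega R) (n k : nat).
Implicit Types (V : Omega -> 'M[R]_(n, k)).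

Lemma measurable_proj_sq d' (T : measurableType d') (X : T -> 'rV[R]_n)
    (V : T -> 'M[R]_(n, k)) : random_mx X -> random_mx V ->
  measurable_fun setT (fun w => dotp (X w *m V w) (X w *m V w)).
Proof.
move=> mX mV; apply: measurable_sum => i.
suff mXV : measurable_fun setT (fun w => (X w *m V w) ord0 i) by exact: measurable_funM.
under eq_fun do rewrite mxE.
by apply: measurable_sum => j; apply: measurable_funM; exact: random_mx_coord.
Qed.

Lemma measurable_dotp d' (T : measurableType d') (X : T -> 'rV[R]_n) :
  random_mx X -> measurable_fun setT (fun w => dotp (X w) (X w)).
Proof.
by move=> mX; apply: measurable_sum => i; apply: measurable_funM; exact: random_mx_coord.
Qed.

Lemma random_mx_id m p : random_mx (fun x : borel_mx R m p => x : 'M[R]_(m, p)).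
Proof. exact: measurable_id. Qed.

Section FixedVector.
Variable V : Omega -> 'M[R]_(n, k).
Hypothesis uV : uniform_stiefel P V.
Local Open Scope ereal_scope.

Let mV : random_mx V. Proof. by case: uV. Qed.

Let psi (g : 'rV[R]_n) := \int[P]_w (dotp (g *m V w) (g *m V w))%:E.

Let psi_ge0 g : 0 <= psi g.
Proof. by apply: integral_ge0 => w _; rewrite lee_fin dotp_ge0. Qed.

Let psi_orthogonal g (U : 'M[R]_n) : (U^T *m U = 1%:M)%R -> psi (g *m U)%R = psi g.
Proof.
move=> orthU; case: uV => _ _ /(_ U orthU) inv.
have mUV : random_mx (fun w => U *m V w)%R.
  apply: coord_random_mx => i j; under eq_fun do rewrite mxE.
  apply: measurable_sum => l; apply: measurable_funM; first exact: measurable_cst.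
  exact: random_mx_coord.
pose h (M : borel_mx R n k) := (dotp (g *m M) (g *m M))%:E.
have mh : measurable_fun setT h.
  apply/measurable_EFinP; apply: measurable_proj_sq; last exact: random_mx_id.
  exact: measurable_cst.
have h0 M : 0 <= h M by rewrite lee_fin dotp_ge0.
transitivity (\int[P]_w (h \o (fun w => U *m V w)%R) w).
  by apply: eq_integral => w _; rewrite /h/= mulmxA.
rewrite -(@ge0_integral_pushforward _ _ _ _ _ _ mUV P setT h)//.
rewrite -[RHS](@ge0_integral_pushforward _ _ _ _ _ _ mV P setT h)//.
by apply: eq_measure_integral => A mA _; exact: inv.
Qed.

Let psi_delta : \sum_(a < n) psi (delta_mx ord0 a) = k%:R%:E.
Proof.
rewrite -ge0_integral_sum//; last 2 first.
- move=> a; apply/measurable_EFinP; apply: measurable_proj_sq => //.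
  exact: measurable_cst.
- by move=> a w _; rewrite lee_fin dotp_ge0.
rewrite (ae_eq_integral (cst k%:R%:E))//.
- by rewrite integral_cst//= probability_setT mule1.
- apply: emeasurable_sum => a; apply/measurable_EFinP; apply: measurable_proj_sq => //.
  exact: measurable_cst.
case: uV => _ + _; apply: filterS => w stV _ /=.
rewrite sumEFin; congr (_%:E); rewrite exchange_big/=.
transitivity (\sum_(i < k) (1 : R))%R; last by rewrite sumr_const card_ord.
apply: eq_bigr => i _; rewrite -(stiefel_col_unit stV i).
by apply: eq_bigr => a _; rewrite -!rowE !mxE.
Qed.

(** By the orthogonal invariance of [V] the mean of [|V^T g|^2] depends on [|g|]
only, and summing it over an orthonormal basis gives [k]. *)
Lemma expected_projection g : (0 < n)%N ->
  psi g = (k%:R / n%:R * dotp g g)%:E.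
Proof.
move=> n0.
have psiE a : psi g = (dotp g g)%:E * psi (delta_mx ord0 a).
  (* [g] is the image of [l2norm g *: delta_mx ord0 a] by an orthogonal map. *)
  have gg : (dotp g g = dotp (l2norm g *: delta_mx ord0 a) (l2norm g *: delta_mx ord0 a))%R.
    rewrite dotpZl dotpZr mulrA -expr2 sqr_l2norm -[LHS]mulr1; congr (_ * _)%R.
    rewrite /dotp (bigD1 a)//= big1 ?addr0 ?mxE ?eqxx ?mulr1//.
    by move=> j ja; rewrite mxE (negbTE ja) andbF mul0r.
  have [U orthU gE] := orthogonal_transitive (esym gg).
  rewrite -{1}gE psi_orthogonal// /psi -ge0_integralZl//; last 3 first.
  - by apply/measurable_EFinP; apply: measurable_proj_sq => //; exact: measurable_cst.
  - by move=> w _; rewrite lee_fin dotp_ge0.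
  - by rewrite lee_fin dotp_ge0.
  apply: eq_integral => w _; rewrite -EFinM; congr (_%:E).
  by rewrite -!scalemxAl dotpZl dotpZr mulrA -expr2 sqr_l2norm.
(* Sum [psiE] over the orthonormal basis. *)
have : \sum_(a < n) psi g = (dotp g g * k%:R)%:E.
  under eq_bigr => a _ do rewrite (psiE a).
  rewrite -ge0_sume_distrr; last by move=> a _; exact: psi_ge0.
  by rewrite psi_delta EFinM.
have -> : \sum_(a < n) psi g = n%:R%:E * psi g.
  elim: (n : nat) => [|m ih]; first by rewrite big_ord0 mul0e.
  by rewrite big_ord_recr/= ih -natr1 EFinD ge0_muleDl// mul1e.
move=> /(congr1 (fun x => n%:R^-1%:E * x)).
rewrite muleA -!EFinM mulVf ?pnatr_eq0 -?lt0n// mul1e => ->.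
by congr (_%:E); ring.
Qed.

End FixedVector.
End Uniform.

(** * Independence of the past *)

Section Past.
Context {R : realType} (d : measure_display) (Omega : measurableType d).
Context (P : probability Omega R) (n k : nat) (V : nat -> Omega -> 'M[R]_(n, k)).

(** A pi-system generating the sigma-algebra of [V 0, ..., V (t - 1)]. *)
Definition past (t : nat) : set (set Omega) :=
  [set S | exists2 A : nat -> set (borel_mx R n k), (forall j, measurable (A j)) &
     S = \bigcap_(j in `I_t) [set w | A j (V j w)]].

Lemma past_setI t : setI_closed (past t).
Proof.
move=> _ _ [A mA ->] [B mB ->]; exists (fun j => A j `&` B j).
  by move=> j; exact: measurableI.
by rewrite -bigcapI.
Qed.

Lemma past_random_mx t s : (s < t)%N ->
  @random_mx R n k _ (g_sigma_algebraType (past t)) (V s).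
Proof.
move=> st _ B mB; rewrite setTI; apply: sub_sigma_algebra.
exists (fun j => if j == s then B else setT).
  by move=> j; case: ifP.
apply/seteqP; split => w /= h.
  by move=> j _ /=; case: eqP => // ->.
by have := h s st; rewrite /= eqxx.
Qed.

Hypotheses (mV : forall t, random_mx (V t)) (iV : independent_mx P V).

Lemma past_measurable t : past t `<=` @measurable _ Omega.
Proof.
move=> _ [A mA ->]; apply: bigcap_measurableType => j _.
by rewrite -[X in measurable X]setTI; exact: mV.
Qed.

Let past_indep t S (B : set (borel_mx R n k)) : past t S -> measurable B ->
  P (S `&` V t @^-1` B) = (P S * P (V t @^-1` B))%E.
Proof.
move=> [A mA ->] mB.
pose J : {fset nat} := [fset j in iota 0 t]%fset.
have JE : [set` J] = `I_t.
  by apply/seteqP; split => j /=; rewrite !inE mem_iota add0n.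
(* With [B] at index [t], the joint event is again a product event. *)
pose A' j := if j == t then B else A j.
have mA' j : measurable (A' j) by rewrite /A'; case: ifP.
have A't j : (j < t)%N -> A' j = A j by move=> jt; rewrite /A' ltn_eqF.
have E1 : \bigcap_(j in `I_t) [set w | A j (V j w)] =
    \bigcap_(j in [set` J]) [set w | A' j (V j w)].
  by rewrite JE; apply: eq_bigcapr => j /= jt; rewrite A't.
have E2 : \bigcap_(j in [set` J]) [set w | A' j (V j w)] `&` V t @^-1` B =
    \bigcap_(j in [set` (t |` J)%fset]) [set w | A' j (V j w)].
  apply/seteqP; split => w /=.
    move=> [h Bw] j /=; rewrite !inE => /orP[/eqP ->|jJ]; first by rewrite /A' eqxx.
    by apply: h; rewrite /= !inE.
  move=> h; split; last by have := h t; rewrite /= /A' eqxx; apply; rewrite !inE eqxx.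
  by move=> j jJ; apply: h; rewrite /= !inE; apply/orP; right; move: jJ; rewrite /= !inE.
rewrite E1 E2 !iV// big_fsetU1/=; last by rewrite !inE mem_iota add0n ltnn.
by rewrite muleC; congr (_ * P _)%E; apply/funext => w; rewrite /A' eqxx.
Qed.

(** The product rule passes from the generating pi-system to the whole past by
uniqueness of measures. *)
Lemma past_independent t S (B : set (borel_mx R n k)) : <<s past t >> S ->
  measurable B -> P (S `&` V t @^-1` B) = (P S * P (V t @^-1` B))%E.
Proof.
move=> pS mB.
have mC : measurable (V t @^-1` B).
  by rewrite -[X in measurable X]setTI; exact: mV.
have PC : P (V t @^-1` B) \is a fin_num by exact: fin_num_measure.
pose r : {nonneg R} := NngNum (fine_ge0 (measure_ge0 P (V t @^-1` B))).
(* Compare the measures [S |-> P (S `&` C)] and [S |-> P C * P S], where [C] is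
the preimage of [B]. *)
have := @g_sigma_algebra_measure_unique _ R Omega (past t) (@past_measurable t)
  (fun _ => setT) _ _ (mrestr P mC) (mscale r P) (@past_setI t) _ _ S pS.
rewrite /= /mrestr /mscale/= fineK// muleC; apply.
- by move=> _; exists (fun _ => setT) => //; apply/seteqP; split => // w _ j.
- by apply/seteqP; split => // w _; exists 0%N.
- by move=> T pT; rewrite past_indep// muleC.
- by move=> _; rewrite setTI ltey_eq PC.
Qed.

End Past.

Section JointLaw.
Context {R : realType} (d : measure_display) (Omega : measurableType d).
Context (P : probability Omega R) (n k : nat).
Variables (X : Omega -> 'rV[R]_n) (V : Omega -> 'M[R]_(n, k)).
Hypotheses (mX : random_mx X) (uV : uniform_stiefel P V) (n0 : (0 < n)%N).
Hypothesis indXV : forall (A : set (borel_mx R 1 n)) (B : set (borel_mx R n k)),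
  measurable A -> measurable B ->
  P (X @^-1` A `&` V @^-1` B) = (P (X @^-1` A) * P (V @^-1` B))%E.

(** The pair [(X, V)] has a product law, so the direction can be averaged with
[X] held fixed. *)
Lemma expected_projection_indep :
  (\int[P]_w (dotp (X w *m V w) (X w *m V w))%:E =
   (k%:R / n%:R)%:E * \int[P]_w (dotp (X w) (X w))%:E)%E.
Proof.
have mV : random_mx V by case: uV.
pose X' : {RV P >-> borel_mx R 1 n} :=
  HB.pack (X : Omega -> borel_mx R 1 n) (isMeasurableFun.Build _ _ _ _ _ mX).
pose V' : {RV P >-> borel_mx R n k} :=
  HB.pack (V : Omega -> borel_mx R n k) (isMeasurableFun.Build _ _ _ _ _ mV).
pose Z w : borel_mx R 1 n * borel_mx R n k := (X w, V w).
have mZ : measurable_fun setT Z by apply/measurable_fun_pairP; split.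
pose Z' : {RV P >-> (borel_mx R 1 n * borel_mx R n k)%type} :=
  HB.pack Z (isMeasurableFun.Build _ _ _ _ _ mZ).
pose h (z : borel_mx R 1 n * borel_mx R n k) := (dotp (z.1 *m z.2) (z.1 *m z.2))%:E.
have mh : measurable_fun setT h.
  apply/measurable_EFinP; apply: measurable_proj_sq.
    exact: measurable_fst.
  exact: measurable_snd.
have h0 z : (0 <= h z)%E by rewrite lee_fin dotp_ge0.
transitivity (\int[P]_w (h \o Z') w)%E; first by [].
rewrite -ge0_integral_distribution//.
rewrite (eq_measure_integral (distribution P X' \x distribution P V')%E); last first.
  move=> S mS _; apply/esym; apply: product_measure_unique => //.
rewrite fubini_tonelli1//.
pose q (x : borel_mx R 1 n) := (k%:R / n%:R * dotp x x)%:E.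
transitivity (\int[distribution P X']_x q x)%E.
  apply: eq_integral => x _.
  rewrite /q -(expected_projection uV x n0) /fubini_F ge0_integral_distribution//.
  apply/measurable_EFinP; apply: measurable_proj_sq; last exact: random_mx_id.
  exact: measurable_cst.
rewrite ge0_integral_distribution.
- rewrite -ge0_integralZl//.
  + by apply/measurable_EFinP; exact: measurable_dotp.
  + by move=> w _; rewrite lee_fin dotp_ge0.
- apply/measurable_EFinP; apply: measurable_funM; first exact: measurable_cst.
  by apply: measurable_dotp; exact: random_mx_id.
- by move=> x; rewrite lee_fin mulr_ge0 ?dotp_ge0// divr_ge0.
Qed.

End JointLaw.

(** * One trajectory *)

Section Delta.
Context {R : realType} (delta0 : R).
Hypothesis (hdelta0 : 0 < delta0 <= 1).

Lemma szgd_delta_bounds t : 0 < szgd_delta delta0 t <= 1.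
Proof. by elim: t => //= t; lra. Qed.

Lemma szgd_delta_cvg0 : szgd_delta delta0 @ \oo --> (0 : R).
Proof.
rewrite (_ : szgd_delta delta0 = geometric delta0 2^-1).
  by apply: cvg_geometric; rewrite ger0_norm ?invr_ge0// invf_lt1 ?ltr1n.
apply/funext; elim=> [|t ih]; first by rewrite /= expr0 mulr1.
by rewrite /= ih /= exprSr mulrA.
Qed.

End Delta.

Section Trajectory.
Context {R : realType} (n k : nat) (f : 'rV[R]_n -> R) (L : R).
Variables (x0 : 'rV[R]_n) (delta0 : R) (eta : nat -> R) (etam etap : R).
Hypotheses (hk : (1 <= k <= n)%N) (hdelta0 : 0 < delta0 <= 1).
Hypotheses (hL : 0 < L) (hsmooth : smooth L f).
Hypotheses (hetam : 0 < etam) (heta : forall t, etam <= eta t <= etap).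
Hypothesis hetap : etap < 2 * k%:R / (L * n%:R).
Variables (xs : 'rV[R]_n) (mu : R).
Hypotheses (crit_xs : critical f xs) (mu0 : 0 < mu).

Let a : R := n%:R / k%:R.
Let eps : R := Num.sqrt k%:R * (L / 2).

(** The coefficients of [szgd_descent] when the gradient is bounded by
[L * mu], as it is on the ball of radius [mu] around a critical point. *)
Definition descent_rate : R := a * etam * (1 - L * a * etap / 2).
Definition descent_error : R :=
  (etap * a + L * (etap * a) ^+ 2) * (L * mu) * eps
  + L / 2 * (etap * a) ^+ 2 * eps ^+ 2.

Notation c := descent_rate.
Notation C := descent_error.
Notation delta := (szgd_delta delta0).

Let n0 : 0 < n%:R :> R.
Proof. by rewrite ltr0n; case/andP: hk; exact: leq_trans. Qed.

Let k0 : 0 < k%:R :> R.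
Proof. by rewrite ltr0n; case/andP: hk. Qed.

Let a0 : 0 < a. Proof. by rewrite divr_gt0. Qed.

Let etap0 : 0 < etap.
Proof. by have /andP[h1 h2] := heta 0; exact: lt_le_trans (le_trans h1 h2). Qed.

Let Laetap : L * a * etap < 2.
Proof.
move: hetap; rewrite ltr_pdivlMr ?mulr_gt0// => h.
have -> : L * a * etap = etap * (L * n%:R) / k%:R by rewrite /a; field; rewrite gt_eqF.
by rewrite ltr_pdivrMr.
Qed.

Lemma descent_rate_gt0 : 0 < c.
Proof. by apply: mulr_gt0; [exact: mulr_gt0|move: Laetap; lra]. Qed.

Lemma descent_error_gt0 : 0 < C.
Proof.
have eps0 : 0 < eps by rewrite !mulr_gt0 ?sqrtr_gt0.
have b0 : 0 < etap * a by rewrite mulr_gt0.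
rewrite /C; apply: ltr_wpDr.
  by rewrite mulr_ge0 ?sqr_ge0// mulr_ge0 ?sqr_ge0// divr_ge0 ?(ltW hL).
apply: mulr_gt0 => //; apply: mulr_gt0; last exact: mulr_gt0.
by rewrite addr_gt0// mulr_gt0// exprn_gt0.
Qed.

Lemma grad_bounded x : l2norm (x - xs) <= mu -> l2norm (grad f x) <= L * mu.
Proof.
move=> xmu; case: hsmooth => _ _ /(_ x xs); rewrite crit_xs subr0.
by move=> /le_trans; apply; rewrite ler_wpM2l// ltW.
Qed.

Lemma gap_bounded x : l2norm (x - xs) <= mu -> `|f x - f xs| <= L / 2 * mu ^+ 2.
Proof.
move=> xmu.
have hi := smooth_upper (ltW hL) hsmooth xs (x - xs).
have lo := smooth_lower (ltW hL) hsmooth xs (x - xs).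
have sq : L / 2 * dotp (x - xs) (x - xs) <= L / 2 * mu ^+ 2.
  rewrite ler_wpM2l ?divr_ge0 ?(ltW hL)// -sqr_l2norm.
  by rewrite ler_pXn2r// nnegrE ?l2norm_ge0// ltW.
have g0 : dotp (grad f xs) (x - xs) = 0.
  by rewrite crit_xs /dotp big1// => i _; rewrite mxE mul0r.
move: hi lo; rewrite g0 (addrC xs) subrK addr0 => hi lo.
by rewrite ler_norml; apply/andP; split; lra.
Qed.

Variable v : nat -> 'M[R]_(n, k).
Notation x := (szgd f x0 delta0 eta v).
Notation p t := (dotp (grad f (x t) *m v t) (grad f (x t) *m v t)).
Hypotheses (stv : forall t, stiefel (v t)) (xball : forall t, l2norm (x t - xs) <= mu).

Lemma trajectory_descent t : f (x t.+1) <= f (x t) - c * p t + C * delta t.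
Proof.
have /andP[d0 d1] := szgd_delta_bounds hdelta0 t.
exact: (szgd_descent hL hsmooth (stv t) d0 hetam (heta t) d1 (ltW Laetap)
  (grad_bounded (xball t))).
Qed.

(** Half of [2 C delta t] pays for the error of the step; the other half is
[2 C delta t.+1], because the radius is halved. *)
Lemma perturbed_value_decreasing t :
  f (x t.+1) + 2 * C * delta t.+1 + c * p t <= f (x t) + 2 * C * delta t.
Proof. by have := trajectory_descent t => /=; lra. Qed.

Let y t := f (x t) + 2 * C * delta t.

Let y_noninc : nonincreasing_seq y.
Proof.
apply/nonincreasing_seqP => t; have := perturbed_value_decreasing t.
have : 0 <= c * p t by rewrite mulr_ge0 ?dotp_ge0// ltW// descent_rate_gt0.
by rewrite /y; lra.
Qed.

Let y_cvg : cvgn y.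
Proof.
apply: nonincreasing_is_cvgn => //; exists (f xs - L / 2 * mu ^+ 2) => _ [t _ <-].
have := gap_bounded (xball t); rewrite ler_norml => /andP[h _].
have /andP[d0 _] := szgd_delta_bounds hdelta0 t.
have : 0 < 2 * C * delta t by rewrite !mulr_gt0// descent_error_gt0.
by rewrite /y; lra.
Qed.

Let pvar_cvg0 : p t @[t --> \oo] --> (0 : R).
Proof.
have /cvg_ex[l yl] := y_cvg.
have yl' : (fun t => c^-1 * (y t - y t.+1)) @ \oo --> (0 : R).
  rewrite -(mulr0 c^-1) -(subrr l); apply: cvgMr; apply: cvgB => //.
  by move: yl; rewrite -cvg_shiftS.
apply: (squeeze_cvgr _ (cvg_cst 0) yl'); apply: nearW => t.
rewrite dotp_ge0/= mulrC ler_pdivlMr ?descent_rate_gt0// mulrC.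
by have := perturbed_value_decreasing t; rewrite /y; lra.
Qed.

Let step_cvg0 : (fun t => x t.+1 - x t) @ \oo --> (0 : 'rV[R]_n).
Proof.
apply/cvgrPdist_lt => e e0.
have lim0 : (fun t => 2 * (etap * a) ^+ 2 * (p t + eps ^+ 2 * delta t)) @ \oo --> (0 : R).
  have -> : 0 = 2 * (etap * a) ^+ 2 * (0 + eps ^+ 2 * 0) :> R by ring.
  apply: cvgMr; apply: cvgD; first exact: pvar_cvg0.
  by apply: cvgMr; exact: szgd_delta_cvg0.
have e2 : 0 < e ^+ 2 by rewrite exprn_gt0.
move/cvgrPdist_lt/(_ _ e2) : lim0; apply: filterS => t /=.
rewrite !sub0r !normrN => h.
have /andP[d0 d1] := szgd_delta_bounds hdelta0 t.
have := szgd_step_small hL hsmooth (x t) (stv t) d0 hetam (heta t) d1.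
move=> /le_lt_trans/(_ (le_lt_trans (ler_norm _) h)).
rewrite ltr_pXn2r// ?nnegrE ?l2norm_ge0 ?(ltW e0)//.
exact: le_lt_trans (normr_le_l2norm _).
Qed.

Hypothesis hiso : isolated_critical_points f.
Variables (theta kappa : R).
Hypotheses (loj : lojasiewicz_at theta f xs kappa mu).
Hypothesis grad0 : dotp (grad f (x t)) (grad f (x t)) @[t --> \oo] --> (0 : R).

Let critical_l2 z : critical f z <-> `|grad f z| = 0.
Proof. by split=> [->|/normr0_eq0//]; rewrite normr0. Qed.

(** A vanishing gradient along the trajectory forces convergence by
[slow_cvg_isolated_zero]. As [l] stays in the ball where the Lojasiewicz
inequality at [xs] holds, [critical f l] gives [f l = f xs]; the last bound
compares the decreasing sequence [y] with its limit [f xs]. *)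
Theorem trajectory_cvg : exists l,
  [/\ x @ \oo --> l, critical f l, f l = f xs &
      forall t, - (2 * C * delta t) <= f (x t) - f xs].
Proof.
have [|t||||l [xl gl]] := @slow_cvg_isolated_zero R n x (fun z => `|grad f z|) (`|xs| + mu).
- case: hsmooth => _ gc _ z.
  exact: (@cvg_norm _ 'rV[R]_n _ (nbhs z) _ _ _ (gc z)).
- rewrite -[x t](subrK xs) (le_trans (ler_normD _ _))// addrC lerD2l.
  exact: le_trans (normr_le_l2norm _) (xball t).
- exact: step_cvg0.
- apply/cvgrPdist_lt => e e0; have e2 : 0 < e ^+ 2 by rewrite exprn_gt0.
  move/cvgrPdist_lt/(_ _ e2) : grad0; apply: filterS => t /=.
  rewrite !sub0r !normrN normr_id ger0_norm ?dotp_ge0// -sqr_l2norm.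
  rewrite ltr_pXn2r// ?nnegrE ?l2norm_ge0 ?(ltW e0)//.
  exact: le_lt_trans (normr_le_l2norm _).
- move=> z /critical_l2 /hiso[e e0 he].
  pose s : R := Num.sqrt n%:R + 1.
  have s0 : 0 < s by rewrite ltr_wpDl ?sqrtr_ge0.
  exists (e / s); first by rewrite divr_gt0.
  move=> w /critical_l2 cw; rewrite ltr_pdivlMr// => h; apply: he => //.
  apply: le_lt_trans h; apply: (le_trans (l2norm_le_normr _)).
  by rewrite mulrC ler_wpM2l// lerDl.
have critl : critical f l by exact/critical_l2.
have fcont : continuous f.
  by move=> z; apply: differentiable_continuous; case: hsmooth.
have lball : l2norm (l - xs) <= mu.
  apply/ler_addgt0Pr => e e0; pose s : R := Num.sqrt n%:R + 1.
  have s0 : 0 < s by rewrite ltr_wpDl ?sqrtr_ge0.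
  have es : 0 < e / s by rewrite divr_gt0.
  have /cvgrPdist_lt/(_ _ es)[N _ /(_ N (leqnn _))/= h] := xl.
  rewrite -(subrK (x N) l) -addrA addrC (le_trans (l2norm_triangle _ _))//.
  apply: lerD; first exact: xball.
  apply: (le_trans (l2norm_le_normr _)); rewrite ltr_pdivlMr// in h.
  by apply: le_trans (ltW h); rewrite mulrC ler_wpM2l// lerDl.
have fl : f l = f xs.
  apply/eqP; rewrite -subr_eq0 -normr_eq0; apply/eqP/(@powR_eq0_eq0 _ _ theta).
  apply/eqP; rewrite eq_le powR_ge0 andbT.
  by have := loj lball; rewrite critl l2norm0 mulr0.
exists l; split => // t; rewrite -fl.
have ylim : y @ \oo --> f l.
  rewrite -[f l]addr0 -[X in _ + X](mulr0 (2 * C)); apply: cvgD.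
    exact: (cvg_comp _ _ xl (fcont l)).
  by apply: cvgMr; exact: szgd_delta_cvg0.
have := nonincreasing_cvgn_ge y_noninc y_cvg t.
by rewrite (cvg_lim _ ylim)// /y; lra.
Qed.

End Trajectory.

(** * Means of bounded random variables *)

Section Mean.
Context {R : realType} (d : measure_display) (Omega : measurableType d).
Context (P : probability Omega R).
Implicit Types Y Z : Omega -> R.

Lemma ae_bounded_integrable Y (M : R) : measurable_fun setT Y ->
  {ae P, forall w, `|Y w| <= M} -> P.-integrable setT (EFin \o Y).
Proof.
move=> mY YM; apply/integrableP; split; first exact/measurable_EFinP.
apply: (@le_lt_trans _ _ (\int[P]_w (cst `|M|%:E) w)%E).
  apply: ae_ge0_le_integral => //.
  - by apply: measurableT_comp => //; exact/measurable_EFinP.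
  - by move=> w _; rewrite lee_fin.
  - by move: YM; apply: filterS => w YM _ /=; rewrite lee_fin (le_trans YM)// ler_norm.
by rewrite integral_cst//= probability_setT mule1 ltry.
Qed.

Lemma ae_le_Rintegral Y Z : P.-integrable setT (EFin \o Y) ->
  P.-integrable setT (EFin \o Z) -> {ae P, forall w, Y w <= Z w} ->
  \int[P]_w Y w <= \int[P]_w Z w.
Proof.
move=> iY iZ YZ; rewrite -subr_ge0 -RintegralB//.
have mY : measurable_fun setT Y by exact/measurable_EFinP/(measurable_int _ iY).
have mZ : measurable_fun setT Z by exact/measurable_EFinP/(measurable_int _ iZ).
rewrite /Rintegral (ae_eq_integral (fun w => (Num.max (Z w - Y w) 0)%:E))//.
- by apply: fine_ge0; apply: integral_ge0 => w _; rewrite lee_fin le_max lexx orbT.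
- by apply/measurable_EFinP; exact: measurable_funB.
- apply/measurable_EFinP; apply: measurable_maxr; last exact: measurable_cst.
  exact: measurable_funB.
- by move: YZ; apply: filterS => w YZ _; rewrite max_l// subr_ge0.
Qed.

(** Finite total mean makes the sum of the series finite almost everywhere, so
its terms vanish in the limit. *)
Lemma ae_cvg0_summable (Y : nat -> Omega -> R) (M : R) :
  (forall t, measurable_fun setT (Y t)) -> (forall t w, 0 <= Y t w) ->
  (forall N, (\sum_(t < N) \int[P]_w (Y t w)%:E <= M%:E)%E) ->
  {ae P, forall w, Y t w @[t --> \oo] --> (0 : R)}.
Proof.
move=> mY Y0 bound.
pose S w := (\sum_(t <oo) (Y t w)%:E)%E.
have Y0' t w : setT w -> (0 <= (Y t w)%:E)%E by rewrite lee_fin.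
have mY' t : measurable_fun setT (fun w => (Y t w)%:E) by exact/measurable_EFinP.
have S0 w : (0 <= S w)%E by apply: nneseries_ge0 => t _ _; rewrite lee_fin.
have iS : P.-integrable setT S.
  apply/integrableP; split.
    by apply: ge0_emeasurable_sum => // t w _ _; rewrite lee_fin.
  under eq_integral do rewrite gee0_abs//.
  rewrite /S integral_nneseries//; apply: (@le_lt_trans _ _ M%:E); last exact: ltry.
  apply: lime_le.
    by apply: is_cvg_nneseries => t _ _; apply: integral_ge0 => w _; exact: Y0'.
  by apply: nearW => N; rewrite big_mkord; exact: bound.
have := integrable_ae measurableT iS; apply: filterS => w /(_ Logic.I) Sfin.
apply: cvg_series_cvg_0; apply: nondecreasing_is_cvgn.
  by apply/nondecreasing_seqP => N; rewrite /series/= big_nat_recr//= lerDl.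
exists (fine (S w)) => _ [N _ <-]; rewrite -lee_fin fineK// /series/= -sumEFin.
by apply: nneseries_lim_ge => t _ _; rewrite lee_fin.
Qed.

End Mean.

(** * The random trajectory *)

Section Szgd.
Context {R : realType} (d : measure_display) (Omega : measurableType d).
Context (P : probability Omega R) (n k : nat) (f : 'rV[R]_n -> R) (L : R).
Variables (x0 : 'rV[R]_n) (delta0 : R) (eta : nat -> R) (etam etap : R).
Variable V : nat -> Omega -> 'M[R]_(n, k).
Hypotheses (hk : (1 <= k <= n)%N) (hdelta0 : 0 < delta0 <= 1).
Hypotheses (hVunif : forall t, uniform_stiefel P (V t)) (hVind : independent_mx P V).
Hypotheses (hL : 0 < L) (hsmooth : smooth L f).
Hypotheses (hetam : 0 < etam) (heta : forall t, etam <= eta t <= etap).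
Hypothesis hetap : etap < 2 * k%:R / (L * n%:R).
Variables (xs : 'rV[R]_n) (mu : R).
Hypotheses (crit_xs : critical f xs) (mu0 : 0 < mu).

Notation X t w := (szgd f x0 delta0 eta (fun s => V s w) t).
Hypothesis ball : {ae P, forall w, forall t, l2norm (X t w - xs) <= mu}.

Notation c := (descent_rate n k L etam etap).
Notation C := (descent_error n k L etap mu).
Notation delta := (szgd_delta delta0).
Let M0 : R := L / 2 * mu ^+ 2.

Let F t w := f (X t w) - f xs.
Let gradsq t w := dotp (grad f (X t w)) (grad f (X t w)).
Let projsq t w := dotp (grad f (X t w) *m V t w) (grad f (X t w) *m V t w).

Let kn0 : 0 < k%:R / n%:R :> R.
Proof.
by case/andP: hk => k0 kn; rewrite divr_gt0 ?ltr0n// (leq_trans k0).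
Qed.

Let c0 : 0 < c. Proof. exact: descent_rate_gt0. Qed.
Let ckn0 : 0 < c * (k%:R / n%:R). Proof. exact: mulr_gt0. Qed.
Let C0 : 0 < C. Proof. exact: (descent_error_gt0 hk hL hetam heta mu0). Qed.

Let fcont : continuous f.
Proof. by move=> z; apply: differentiable_continuous; case: hsmooth. Qed.

Let good : {ae P, forall w,
  (forall t, stiefel (V t w)) /\ (forall t, l2norm (X t w - xs) <= mu)}.
Proof.
have st : {ae P, forall w, forall t, stiefel (V t w)}.
  by apply: ae_foralln => t; case: (hVunif t).
by move: st ball; apply: filterS2.
Qed.

Let mV t : random_mx (V t). Proof. by case: (hVunif t). Qed.

Lemma szgd_iterate_random t : random_mx (fun w => X t w).
Proof. exact: szgd_random_mx. Qed.

Let random_grad d' (T : measurableType d') (Y : T -> 'rV[R]_n) :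
  random_mx Y -> random_mx (fun w => grad f (Y w)).
Proof.
move=> mY; apply: coord_random_mx => i j.
apply: (random_mx_comp (h := fun z => grad f z i j) mY) => z.
case: hsmooth => _ gc _.
exact: (continuous_comp (@gc z) (@coord_continuous _ _ _ i j (grad f z))).
Qed.

Let mF t : measurable_fun setT (F t).
Proof.
apply: measurable_funB; last exact: measurable_cst.
exact: (random_mx_comp (szgd_iterate_random t) fcont).
Qed.

Let mgradsq t : measurable_fun setT (gradsq t).
Proof. by apply: measurable_dotp; apply: random_grad; exact: szgd_iterate_random. Qed.

Let mprojsq t : measurable_fun setT (projsq t).
Proof.
by apply: measurable_proj_sq => //; apply: random_grad; exact: szgd_iterate_random.
Qed.

(** [grad f (X t)] only depends on the frames drawn before [V t], so
[expected_projection_indep] applies. *)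
Let expected_projsq t :
  (\int[P]_w (projsq t w)%:E = (k%:R / n%:R)%:E * \int[P]_w (gradsq t w)%:E)%E.
Proof.
apply: expected_projection_indep => //.
- by apply: random_grad; exact: szgd_iterate_random.
- by case/andP: hk => k0 kn; rewrite (leq_trans k0).
move=> A B mA mB; apply: past_independent => //.
have : @random_mx R 1 n _ (g_sigma_algebraType (past V t)) (fun w => grad f (X t w)).
  apply: random_grad; apply: szgd_random_mx => // s st.
  exact: past_random_mx.
by move=> /(_ measurableT A mA); rewrite setTI.
Qed.

Let abs_F : {ae P, forall w, forall t, `|F t w| <= M0}.
Proof.
by move: good; apply: filterS => w [_ h] t; exact: (gap_bounded hL hsmooth).
Qed.

Let gradsq_le : {ae P, forall w, forall t, gradsq t w <= (L * mu) ^+ 2}.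
Proof.
move: good; apply: filterS => w [_ h] t; rewrite /gradsq -sqr_l2norm.
rewrite ler_pXn2r// ?nnegrE ?l2norm_ge0 ?mulr_ge0 ?(ltW hL) ?(ltW mu0)//.
exact: (grad_bounded hL hsmooth crit_xs (h t)).
Qed.

Let iF t : P.-integrable setT (EFin \o F t).
Proof.
by apply: (ae_bounded_integrable (M := M0)) => //; move: abs_F; apply: filterS.
Qed.

Let iabsF t : P.-integrable setT (EFin \o (fun w => `|F t w|)).
Proof.
apply: (ae_bounded_integrable (M := M0)); first exact: measurableT_comp.
by move: abs_F; apply: filterS => w h; rewrite normr_id.
Qed.

Let igradsq t : P.-integrable setT (EFin \o gradsq t).
Proof.
apply: (ae_bounded_integrable (M := (L * mu) ^+ 2)) => //.
by move: gradsq_le; apply: filterS => w h; rewrite ger0_norm ?dotp_ge0.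
Qed.

Let iprojsq t : P.-integrable setT (EFin \o projsq t).
Proof.
apply: (ae_bounded_integrable (M := (L * mu) ^+ 2)) => //.
move: good gradsq_le; apply: filterS2 => w [st _] h; rewrite ger0_norm ?dotp_ge0//.
exact: le_trans (stiefel_Bessel (st t) _) (h t).
Qed.

Let mean_cst (r : R) : \int[P]_w r = r.
Proof. by rewrite Rintegral_cst//= probability_setT mulr1. Qed.

Let icst (r : R) : P.-integrable setT (EFin \o (fun _ : Omega => r)).
Proof. exact: finite_measure_integrable_cst. Qed.

Let iZ (r : R) (Y : Omega -> R) : P.-integrable setT (EFin \o Y) ->
  P.-integrable setT (EFin \o (fun w => r * Y w)).
Proof.
move=> iY; have := integrableZl measurableT r iY.
by apply: eq_integrable => // w _; rewrite /= EFinM.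
Qed.

Let iD (Y Z : Omega -> R) : P.-integrable setT (EFin \o Y) ->
  P.-integrable setT (EFin \o Z) -> P.-integrable setT (EFin \o (fun w => Y w + Z w)).
Proof.
move=> iY iZ'; have := integrableD measurableT iY iZ'.
by apply: eq_integrable => // w _; rewrite /= EFinD.
Qed.

Let mF_ t := \int[P]_w F t w.
Let e_ t := \int[P]_w gradsq t w.

Let mean_descent t : mF_ t.+1 + c * (k%:R / n%:R) * e_ t <= mF_ t + C * delta t.
Proof.
have -> : c * (k%:R / n%:R) * e_ t = \int[P]_w (c * projsq t w).
  rewrite RintegralZl// -mulrA; congr (_ * _).
  rewrite /e_ /Rintegral expected_projsq fineM//.
  exact: (integrable_fin_num measurableT (igradsq t)).
have iQ := iZ c (iprojsq t).
have -> : mF_ t + C * delta t = \int[P]_w (F t w + C * delta t).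
  by rewrite RintegralD ?mean_cst//.
rewrite -RintegralD//.
apply: ae_le_Rintegral; [exact: iD (iF _) iQ|exact: iD (iF _) (icst _)|].
move: good; apply: filterS => w [st h].
have := trajectory_descent hk hdelta0 hL hsmooth hetam heta hetap crit_xs st h t.
by rewrite /F /projsq; lra.
Qed.

Let e_ge0 t : 0 <= e_ t.
Proof. by apply: Rintegral_ge0 => w _; exact: dotp_ge0. Qed.

Let mF_bound t : `|mF_ t| <= M0.
Proof.
apply: (le_trans (le_normr_Rintegral _ (iF t))) => //.
rewrite -[leRHS]mean_cst; apply: ae_le_Rintegral => //.
by move: abs_F; apply: filterS.
Qed.

Let sum_gradsq N : (\sum_(t < N) \int[P]_w (gradsq t w)%:E <=
  ((2 * M0 + 2 * C) / (c * (k%:R / n%:R)))%:E)%E.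
Proof.
have -> : (\sum_(t < N) \int[P]_w (gradsq t w)%:E)%E = (\sum_(t < N) e_ t)%:E.
  rewrite -sumEFin; apply: eq_bigr => t _; rewrite /e_ /Rintegral fineK//.
  exact: (integrable_fin_num measurableT (igradsq t)).
rewrite lee_fin ler_pdivlMr//.
(* The mean descent telescopes for [mF_ t + 2 * C * delta t]. *)
suff : (\sum_(t < N) e_ t) * (c * (k%:R / n%:R)) <=
    mF_ 0%N + 2 * C * delta 0%N - (mF_ N + 2 * C * delta N).
  have /andP[d0 d1] := szgd_delta_bounds hdelta0 0.
  have /andP[d0' d1'] := szgd_delta_bounds hdelta0 N.
  have h1 : 2 * C * delta 0%N <= 2 * C by rewrite ler_piMr// mulr_ge0// ltW.
  have h2 : 0 <= 2 * C * delta N by rewrite !mulr_ge0 ?(ltW C0) ?(ltW d0').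
  move: (mF_bound 0%N) (mF_bound N); rewrite !ler_norml => /andP[_ h3] /andP[h4 _].
  by lra.
elim: N => [|N ih]; first by rewrite big_ord0 mul0r subrr.
have dN : delta N.+1 = delta N / 2 by [].
by rewrite big_ord_recr dN mulrDl; have := mean_descent N; lra.
Qed.

Hypothesis hiso : isolated_critical_points f.
Variables (theta kappa : R).
Hypotheses (htheta : 0 < theta) (hkappa : 0 < kappa).
Hypotheses (loj : lojasiewicz_at theta f xs kappa mu).

Lemma szgd_ae_cvg : {ae P, forall w, exists l,
  [/\ X t w @[t --> \oo] --> l, critical f l, f l = f xs &
      forall t, - (2 * C * delta t) <= f (X t w) - f xs]}.
Proof.
have := ae_cvg0_summable mgradsq (fun t w => dotp_ge0 _) sum_gradsq.
move: good; apply: filterS2 => w [st h] g0.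
exact: (trajectory_cvg hk hdelta0 hL hsmooth hetam heta hetap crit_xs mu0 st h
  hiso loj g0).
Qed.

Let p : R := Num.max 1 (2 * theta).
Let K : R := kappa ^+ 2 * Num.max 1 (M0 `^ (1 - 2 * theta)).
Let a_ t := \int[P]_w `|F t w|.

Let p1 : 1 <= p. Proof. by rewrite le_max lexx. Qed.

Let K0 : 0 < K.
Proof. by rewrite mulr_gt0 ?exprn_gt0// lt_max ltr01. Qed.

(** Jensen's inequality, in the form of the tangent bound at the mean. *)
Let mean_Lojasiewicz t : a_ t `^ p <= K * e_ t.
Proof.
have a0 : 0 <= a_ t by apply: Rintegral_ge0.
have := a0; rewrite le_eqVlt => /predU1P[<-|apos].
  rewrite powR0; first by rewrite mulr_ge0// ltW.
  by rewrite gt_eqF// (lt_le_trans ltr01).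
have -> : a_ t `^ p = \int[P]_w (a_ t `^ p - p * a_ t `^ (p - 1) * a_ t
    + p * a_ t `^ (p - 1) * `|F t w|).
  by rewrite RintegralD//; [rewrite mean_cst RintegralZl// -/(a_ t) subrK|exact: iZ].
have -> : K * e_ t = \int[P]_w (K * gradsq t w) by rewrite RintegralZl.
apply: ae_le_Rintegral; [|exact: iZ|].
  by apply: iD => //; exact: iZ.
move: good abs_F; apply: filterS2 => w [_ h] hF.
have := powR_tangent (normr_ge0 (F t w)) apos p1.
have := Lojasiewicz_power htheta (normr_ge0 (F t w)) (hF t) (loj (h t)).
by rewrite -/p -/K sqr_l2norm -/(gradsq t w); lra.
Qed.

Let b_ t := mF_ t + 4 * C * delta t.

Let mF_lower t : - (2 * C * delta t) <= mF_ t.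
Proof.
rewrite -[leLHS]mean_cst; apply: ae_le_Rintegral => //.
by move: szgd_ae_cvg; apply: filterS => w [l [_ _ _]].
Qed.

Let Cd t : 0 < C * delta t.
Proof. by rewrite mulr_gt0//; case/andP: (szgd_delta_bounds hdelta0 t). Qed.

(** The recursion behind both rates. The mean gap is at least [- 2 C delta t],
so adding [4 C delta t] makes it dominate its absolute value; and since
[4 C delta t] loses [2 C delta t] per step, it covers the error [C delta t] of
the descent and leaves the spare decrease of [perturbed_recursion]. *)
Lemma mean_gap_recursion : exists b : nat -> R,
  [/\ forall t, `|\int[P]_w (f (X t w) - f xs)| <= b t &
      exists2 c', 0 < c' &
        forall t, b t.+1 <= b t - c' * b t `^ Num.max 1 (2 * theta)].
Proof.
exists b_; split=> [t|].
  rewrite -/(mF_ t) ler_norml /b_; have := mF_lower t; have := Cd t.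
  by move=> ? ?; apply/andP; split; lra.
apply: (@perturbed_recursion _ a_ b_ delta C (c * (k%:R / n%:R) / K) p) => //.
- exact: divr_gt0.
- exact: szgd_delta_bounds.
- by move=> t; apply: Rintegral_ge0.
- by move=> t; rewrite /b_; have := mF_lower t; have := Cd t; lra.
- move=> t; rewrite /b_ lerD2r; apply: ae_le_Rintegral => //.
  by apply/aeW => w; exact: ler_norm.
move=> t; have hJ : c * (k%:R / n%:R) / K * a_ t `^ p <= c * (k%:R / n%:R) * e_ t.
  rewrite -mulrA ler_wpM2l ?(ltW ckn0)//.
  by rewrite mulrC ler_pdivrMr// mulrC mean_Lojasiewicz.
by rewrite /b_ /=; have := mean_descent t; lra.
Qed.

Lemma mean_gap_integrable t : P.-integrable setT (EFin \o (fun w => f (X t w) - f xs)).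
Proof. exact: iF. Qed.

End Szgd.

(** * Convergence and rates *)

Theorem theorem3 (R : realType) (d : measure_display) (Omega : measurableType d)
    (P : probability Omega R) (n k : nat) (hk : (1 <= k <= n)%N)
    (f : 'rV[R]_n -> R) (L theta : R)
    (x0 : 'rV[R]_n) (delta0 : R) (hdelta0 : 0 < delta0 <= 1)
    (eta : nat -> R) (V : nat -> Omega -> 'M[R]_(n, k))
    (hVunif : forall t, uniform_stiefel P (V t))
    (hVind : independent_mx P V)
    (x : nat -> Omega -> 'rV[R]_n)
    (hx : forall t w, x t w = szgd f x0 delta0 eta (fun s => V s w) t)
    (hL : 0 < L) (hsmooth : smooth L f)
    (htheta : 0 < theta < 1) (hloj : lojasiewicz theta f)
    (hinf : has_lbound (range f))
    (hiso : isolated_critical_points f)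
    (hball : exists (xs : 'rV[R]_n) (kappa mu : R),
       [/\ critical f xs, 0 < kappa, 0 < mu,
           lojasiewicz_at theta f xs kappa mu &
           {ae P, forall w, forall t, l2norm (x t w - xs) <= mu}])
    (etam etap : R) (hetam : 0 < etam)
    (heta : forall t, etam <= eta t <= etap)
    (hetap : etap < 2 * k%:R / (L * n%:R)) :
  exists xoo : Omega -> 'rV[R]_n,
    [/\ random_mx xoo,
        {ae P, forall w, x ^~ w @ \oo --> xoo w /\ critical f (xoo w)},
        (0 < theta <= 2^-1 ->
         -1 <= L * n%:R * etam ^+ 2 / (2 * k%:R) - etam < 0 ->
         -1 <= L * n%:R * etap ^+ 2 / (2 * k%:R) - etap < 0 ->
         exists2 Q : R, 1 < Q &
           (fun t => 'E_P[fun w => (Q ^+ t * (f (x t w) - f (xoo w)))%R])%E @ \oo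
             --> (0 : \bar R)%E) &
        (2^-1 < theta < 1 ->
         0 < etam < 2 * k%:R / (L * n%:R) ->
         0 < etap < 2 * k%:R / (L * n%:R) ->
         exists C : R, \forall t \near \oo,
           (`| 'E_P[fun w => (f (x t w) - f (xoo w))%R] |
              <= (C * t%:R `^ (1 / (1 - 2 * theta)))%:E)%E)].
Proof.
have [xs [kappa [mu [crit_xs kappa0 mu0 loj ball]]]] := hball.
have {hx}xE : x = fun t w => szgd f x0 delta0 eta (fun s => V s w) t.
  by apply/funext => t; apply/funext => w.
subst x.
have n0 : (0 < n)%N by case/andP: hk => k0 /(leq_trans k0).
have [th0 th1] := andP htheta.
have mX := @szgd_iterate_random _ _ _ P n k f L x0 delta0 eta V hVunif hsmooth.
have cvgX := szgd_ae_cvg hk hdelta0 hVunif hVind hL hsmooth hetam heta hetap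
  crit_xs mu0 ball hiso loj.
have [b [gap_le rec]] := mean_gap_recursion hk hdelta0 hVunif hVind hL hsmooth
  hetam heta hetap crit_xs mu0 ball hiso th0 kappa0 loj.
have iF := mean_gap_integrable hVunif hL hsmooth crit_xs mu0 ball.
have [xoo mxoo xooE] := random_mx_limit mX.
have fcont : continuous f.
  by move=> z; apply: differentiable_continuous; case: hsmooth.
(* Almost surely [f (xoo w)] is the constant [f xs]. *)
have gapE (r : R) t : ('E_P[fun w => (r * (f (szgd f x0 delta0 eta (fun s => V s w) t)
      - f (xoo w)))%R] = (r * \int[P]_w (f (szgd f x0 delta0 eta (fun s => V s w) t)
      - f xs))%:E)%E.
  have mfX := random_mx_comp (mX t) fcont.
  rewrite -RintegralZl// /Rintegral fineK; last first.
    by apply: integrable_fin_num => //; have := integrableZl measurableT r (iF t);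
      apply: eq_integrable.
  rewrite unlock; apply: ae_eq_integral => //.
  - apply/measurable_EFinP; apply: measurable_funM; first exact: measurable_cst.
    by apply: measurable_funB => //; exact: random_mx_comp mxoo fcont.
  - apply/measurable_EFinP; apply: measurable_funM; first exact: measurable_cst.
    by apply: measurable_funB => //; exact: measurable_cst.
  - move: cvgX; apply: filterS => w [l [Xl _ fl _]] _.
    by rewrite (xooE w l Xl) fl.
exists xoo; split => //.
- by move: cvgX; apply: filterS => w [l [Xl critl _ _]]; rewrite (xooE w l Xl).
- move=> /andP[_ th2] _ _.
  have p1 : Num.max 1 (2 * theta) = 1 by apply/max_idPl; lra.
  have b0 t : 0 <= b t by rewrite (le_trans _ (gap_le t)).
  have [|Q Q1 hQ] := dominated_geometric_cvg0 gap_le.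
    by case: rec => c' c'0 hc'; exists c' => // t; have := hc' t; rewrite p1 powRr1.
  by exists Q => //; under eq_fun do rewrite gapE.
- move=> /andP[th2 _] _ _.
  have p2 : Num.max 1 (2 * theta) = 1 + (2 * theta - 1).
    by rewrite (_ : 1 + _ = 2 * theta); [apply/max_idPr; lra|ring].
  have b0 t : 0 <= b t by rewrite (le_trans _ (gap_le t)).
  have [c' c'0 hc'] := rec; rewrite p2 in hc'.
  have s0 : 0 < 2 * theta - 1 by lra.
  have decay := polynomial_decay c'0 s0 b0 hc'.
  exists (((2 * theta - 1) * c') `^ (- (2 * theta - 1)^-1)).
  exists 1%N => // t /= t1.
  have := gapE 1 t; rewrite mul1r.
  have -> : (fun w => 1 * (f (szgd f x0 delta0 eta (fun s => V s w) t) - f (xoo w))) =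
      (fun w => f (szgd f x0 delta0 eta (fun s => V s w) t) - f (xoo w)).
    by apply/funext => w; rewrite mul1r.
  move=> ->; rewrite abse_EFin lee_fin.
  rewrite (_ : 1 / (1 - 2 * theta) = - (2 * theta - 1)^-1).
    exact: le_trans (gap_le t) (decay t t1).
  by rewrite mul1r -opprB invrN.
Qed.
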